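(* Let $H_0,H_1$ be complex Hilbert spaces and let $C\colon\operatorname{dom}(C)\subseteq H_0\to H_1$ be densely defined and closed with $\operatorname{dom}(C)\cap\ker(C)^\bot\hookrightarrow H_0$ compact and with $\ker(C)$ infinite-dimensional. Then there exists $0\leq\gamma=\gamma^*\in L(H_0)$ such that $$-\begin{pmatrix}\gamma&0\\0&0\end{pmatrix}-\begin{pmatrix}0&-C^*\\ C&0\end{pmatrix},$$ considered on the state space $H_0\times\operatorname{ran}(C)$, generates a strongly stable $C_0$-semigroup which is not semi-uniformly stable.
   Context: $L(X)$ denotes the bounded linear operators on $X$. $\operatorname{dom}(C)$ carries the graph norm. Under the compactness assumption $\operatorname{ran}(C)\subseteq H_1$ is closed, so that $H_0\times\operatorname{ran}(C)$ is a Hilbert space; the operator on it has domain $\operatorname{dom}(C)\times(\operatorname{dom}(C^* )\cap\operatorname{ran}(C))$. A $C_0$-semigroup $T$ on $X$ with generator $G$ is strongly stable if $\lim_{t\to\infty}\|T(t)x\|=0$ for all $x\in X$; it is semi-uniformly stable if there exists $f\colon[0,\infty)\to[0,\infty)$ with $f(t)\to0$ as $t\to\infty$ such that $\|T(t)x\|\le f(t)\|x\|_{\operatorname{dom}(G)}$ for all $x\in\operatorname{dom}(G)$ and $t\ge0$, where $\|\cdot\|_{\operatorname{dom}(G)}$ is the graph norm. *)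

(* Defs.v *)
From HB Require Import structures.
From mathcomp Require Import all_boot all_order all_algebra complex.
From mathcomp Require Import all_classical all_reals all_analysis.
From mathcomp Require Import ring.
Set Implicit Arguments.
Unset Strict Implicit.
Unset Printing Implicit Defensive.
Import Order.TTheory GRing.Theory Num.Theory Num.Def.
Import numFieldNormedType.Exports.
Local Open Scope classical_set_scope.
Local Open Scope ring_scope.
Local Open Scope complex_scope.

(* Complex Hilbert spaces. The scalar product is linear in its first argument
   and conjugate-linear in its second one. *)
HB.mixin Record CompleteNormedModule_isHilbert (R : realType) H
    & CompleteNormedModule R[i] H := {
  inner : {dot H for conjC} ;
  normsq_inner : forall x : H, `|x| ^+ 2 = inner x x }.

#[short(type="hilbertType")]
HB.structure Definition Hilbert (R : realType) :=
  {H of CompleteNormedModule_isHilbert R H & CompleteNormedModule R[i] H}.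

(* The Hilbert space product; the library instance on [U * V] has the max norm
   instead, hence the alias. *)
Definition hprod (U V : Type) : Type := (U * V)%type.

Definition hpair (U V : Type) (x : U) (y : V) : hprod U V := (x, y).

Section HilbertProduct.
Variables (R : realType) (U V : hilbertType R).

HB.instance Definition _ := GRing.Lmodule.copy (hprod U V) (U * V)%type.

Definition hprod_inner (z w : hprod U V) : R[i] :=
  inner z.1 w.1 + inner z.2 w.2.

Let hprod_innerBl w : zmod_morphism (hprod_inner ^~ w).
Proof. by move=> x y; rewrite /hprod_inner /= !linearBl opprD addrACA. Qed.

Let hprod_innerBr w : zmod_morphism (hprod_inner w).
Proof. by move=> x y; rewrite /hprod_inner /= !linearBr opprD addrACA. Qed.

Let hprod_innerZl w : scalable_for *%R (hprod_inner ^~ w).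
Proof. by move=> a x; rewrite /hprod_inner /= !linearZl_LR mulrDr. Qed.

Let hprod_innerZr w : scalable_for (conjC \; *%R) (hprod_inner w).
Proof. by move=> a x; rewrite /hprod_inner /= !linearZr_LR /= mulrDr. Qed.

HB.instance Definition _ := isBilinear.Build R[i] (hprod U V)
  (hprod U V) R[i] *%R (conjC \; *%R) hprod_inner
  hprod_innerBl hprod_innerBr hprod_innerZl hprod_innerZr.

Let hprod_hermitian (z w : hprod U V) :
  hprod_inner z w = (-1) ^+ false * conjC (hprod_inner w z).
Proof.
rewrite /hprod_inner rmorphD /= [inner z.1 _]hermitian_subproof.
by rewrite [inner z.2 _]hermitian_subproof !expr0 !mul1r.
Qed.

HB.instance Definition _ := isHermitianSesquilinear.Build R[i] (hprod U V)
  false conjC hprod_inner hprod_hermitian.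

Let hprod_innerE (z : hprod U V) :
  hprod_inner z z = `|z.1| ^+ 2 + `|z.2| ^+ 2.
Proof. by rewrite !normsq_inner. Qed.

Let hprod_dot (z : hprod U V) : z != 0 -> 0 < hprod_inner z z.
Proof.
move=> z0; rewrite hprod_innerE lt_def addr_ge0 ?exprn_ge0 // andbT.
apply: contraNneq z0 => /eqP.
rewrite paddr_eq0 ?exprn_ge0 // !expf_eq0 /= !normr_eq0 => /andP[/eqP z1 /eqP z2].
by case: z z1 z2 => x y /= -> ->.
Qed.

HB.instance Definition _ := isDotProduct.Build R[i] (hprod U V)
  hprod_inner hprod_dot.

Definition hprod_norm (z : hprod U V) : R[i] :=
  sqrtC (`|z.1| ^+ 2 + `|z.2| ^+ 2).

Let hprod_norm_ge0 z : 0 <= hprod_norm z.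
Proof. by rewrite sqrtC_ge0 addr_ge0 ?exprn_ge0. Qed.

Let cauchy2 (a b c d : R[i]) : 0 <= a -> 0 <= b -> 0 <= c -> 0 <= d ->
  a * c + b * d <= sqrtC (a ^+ 2 + b ^+ 2) * sqrtC (c ^+ 2 + d ^+ 2).
Proof.
move=> a0 b0 c0 d0.
have s0 : 0 <= sqrtC (a ^+ 2 + b ^+ 2) by rewrite sqrtC_ge0 addr_ge0 ?exprn_ge0.
have t0 : 0 <= sqrtC (c ^+ 2 + d ^+ 2) by rewrite sqrtC_ge0 addr_ge0 ?exprn_ge0.
rewrite -(@ler_pXn2r _ 2) ?nnegrE ?addr_ge0 ?mulr_ge0 //.
rewrite exprMn !sqrtCK -subr_ge0.
have -> : (a ^+ 2 + b ^+ 2) * (c ^+ 2 + d ^+ 2) - (a * c + b * d) ^+ 2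
  = (a * d - b * c) ^+ 2 by ring.
by apply: real_exprn_even_ge0 => //; rewrite rpredB // ger0_real ?mulr_ge0.
Qed.

Let hprod_ler_normD z w : hprod_norm (z + w) <= hprod_norm z + hprod_norm w.
Proof.
rewrite -(@ler_pXn2r _ 2) ?nnegrE ?addr_ge0 //.
rewrite sqrrD /hprod_norm !sqrtCK.
apply: (@le_trans _ _ ((`|z.1| + `|w.1|) ^+ 2 + (`|z.2| + `|w.2|) ^+ 2)).
  by apply: lerD; rewrite ler_pXn2r ?nnegrE ?addr_ge0 // ler_normD.
have := cauchy2 (normr_ge0 z.1) (normr_ge0 z.2) (normr_ge0 w.1) (normr_ge0 w.2).
rewrite -(ler_pMn2r (isT : (0 < 2)%N)).
set s := sqrtC _ * sqrtC _ => h.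
rewrite -subr_ge0 in h; rewrite -subr_ge0.
by apply: le_trans h _; rewrite le_eqVlt; apply/orP; left; apply/eqP; ring.
Qed.

Let hprod_normrZ (l : R[i]) z : hprod_norm (l *: z) = `|l| * hprod_norm z.
Proof.
rewrite /hprod_norm /= !normrZ !exprMn -mulrDr sqrtCM ?nnegrE ?exprn_ge0 //.
by rewrite sqrCK.
Qed.

Let hprod_norm0_eq0 z : hprod_norm z = 0 -> z = 0.
Proof.
move=> /eqP; rewrite sqrtC_eq0 -hprod_innerE => z0.
by apply/eqP; apply: contraTT z0 => /hprod_dot /lt0r_neq0.
Qed.

HB.instance Definition _ := Lmodule_isNormed.Build R[i] (hprod U V)
  hprod_ler_normD hprod_normrZ hprod_norm0_eq0.

Lemma hprod_normE (z : hprod U V) : `|z| = sqrtC (`|z.1| ^+ 2 + `|z.2| ^+ 2).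
Proof. by []. Qed.

Lemma hprod_norm1 (z : hprod U V) : `|z.1| <= `|z|.
Proof.
rewrite hprod_normE -{1}(sqrCK (normr_ge0 z.1)) ler_sqrtC ?qualifE /= ?addr_ge0 ?exprn_ge0//.
by rewrite lerDl exprn_ge0.
Qed.

Lemma hprod_norm2 (z : hprod U V) : `|z.2| <= `|z|.
Proof.
rewrite hprod_normE -{1}(sqrCK (normr_ge0 z.2)) ler_sqrtC ?qualifE /= ?addr_ge0 ?exprn_ge0//.
by rewrite lerDr exprn_ge0.
Qed.

Lemma hprod_norm_leD (z : hprod U V) : `|z| <= `|z.1| + `|z.2|.
Proof.
rewrite hprod_normE -(@ler_pXn2r _ 2) ?nnegrE ?addr_ge0 ?sqrtC_ge0 ?exprn_ge0 //.
by rewrite sqrtCK sqrrD addrAC lerDl mulrn_wge0 ?mulr_ge0.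
Qed.

Let hprod_cauchy_cvg (F : set_system (hprod U V)) :
  ProperFilter F -> cauchy F -> cvg F.
Proof.
move=> FF /cauchy_ballP Fc.
have c1 : cauchy ((fun z : hprod U V => z.1) @ F).
  apply/cauchy_ballP => e e0; have := Fc _ e0.
  rewrite !near_simpl => -[[A B] [/= FA FB] AB].
  exists ((@fst U V @` A), (@fst U V @` B)) => /=.
    split; [apply: filterS FA => z Az|apply: filterS FB => z Bz]; by exists z.
  move=> [x y] /= [[z Az <-] [w Bw <-]].
  have := AB (z, w) (conj Az Bw); rewrite -!ball_normE /ball_ /=.
  exact: le_lt_trans (hprod_norm1 (z - w)).
have c2 : cauchy ((fun z : hprod U V => z.2) @ F).
  apply/cauchy_ballP => e e0; have := Fc _ e0.
  rewrite !near_simpl => -[[A B] [/= FA FB] AB].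
  exists ((@snd U V @` A), (@snd U V @` B)) => /=.
    split; [apply: filterS FA => z Az|apply: filterS FB => z Bz]; by exists z.
  move=> [x y] /= [[z Az <-] [w Bw <-]].
  have := AB (z, w) (conj Az Bw); rewrite -!ball_normE /ball_ /=.
  exact: le_lt_trans (hprod_norm2 (z - w)).
have [x Fx] : exists x : U, (fun z : hprod U V => z.1) @ F --> x.
  by apply/cvg_ex; apply: cauchy_cvg.
have [y Fy] : exists y : V, (fun z : hprod U V => z.2) @ F --> y.
  by apply/cvg_ex; apply: cauchy_cvg.
suff : F --> (hpair x y : hprod U V) by exact: cvgP.
apply/cvgrPdist_lt => /= e e0; near=> z.
apply: le_lt_trans (hprod_norm_leD _) _ => /=; rewrite [e]splitr ltrD //.
  near: z; move/cvgrPdist_lt : Fx; apply; exact: divr_gt0.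
near: z; move/cvgrPdist_lt : Fy; apply; exact: divr_gt0.
Unshelve. all: by end_near. Qed.

HB.instance Definition _ := Uniform_isComplete.Build (hprod U V) hprod_cauchy_cvg.

Let hprod_normsq_inner (z : hprod U V) : `|z| ^+ 2 = hprod_inner z z.
Proof. by rewrite hprod_normE sqrtCK hprod_innerE. Qed.

HB.instance Definition _ := CompleteNormedModule_isHilbert.Build R (hprod U V)
  hprod_normsq_inner.

End HilbertProduct.

(* [opfun] is only meaningful on [dom]. *)
Record operator (U V : Type) := Operator { dom : set U ; opfun :> U -> V }.

Definition op_eq (U V : Type) (A B : operator U V) : Prop :=
  dom A = dom B /\ forall x, dom A x -> A x = B x.

Section Operators.
Variable R : realType.

Definition subspace_set (U : lmodType R[i]) (S : set U) : Prop :=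
  S 0 /\ forall (a : R[i]) x y, S x -> S y -> S (a *: x + y).

Definition finite_dim (U : lmodType R[i]) (S : set U) : Prop :=
  exists (n : nat) (e : 'I_n -> U), (forall i, S (e i)) /\
    forall x, S x -> exists c : 'I_n -> R[i], x = \sum_i c i *: e i.

Definition linear_on (U V : lmodType R[i]) (S : set U) (f : U -> V) : Prop :=
  forall (a : R[i]) x y, S x -> S y -> f (a *: x + y) = a *: f x + f y.

Definition linear_op (U V : lmodType R[i]) (A : operator U V) : Prop :=
  subspace_set (dom A) /\ linear_on (dom A) A.

Definition ker (U V : lmodType R[i]) (A : operator U V) : set U :=
  [set x | dom A x /\ A x = 0].

Definition ran (U V : Type) (A : operator U V) : set V := A @` dom A.

Definition bounded_on (U V : normedModType R[i]) (S : set U) (f : U -> V) :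
    Prop :=
  exists M : R[i], forall x, S x -> `|f x| <= M * `|x|.

Definition densely_defined (U V : normedModType R[i]) (A : operator U V) :
    Prop :=
  dense (dom A).

Definition closed_op (U V : normedModType R[i]) (A : operator U V) : Prop :=
  closed [set z : U * V | dom A z.1 /\ z.2 = A z.1].

Definition graph_norm (U V : normedModType R[i]) (A : operator U V) (x : U) :
    R[i] :=
  sqrtC (`|x| ^+ 2 + `|A x| ^+ 2).

(* Compactness of the inclusion into [U] of the subspace [E] of [dom A], [E]
   being normed by the graph norm of [A]. *)
Definition compact_graph_embedding (U V : normedModType R[i])
    (A : operator U V) (E : set U) : Prop :=
  precompact [set x | E x /\ graph_norm A x <= 1].

Definition orthogonal_compl (H : hilbertType R) (S : set H) : set H :=
  [set x | forall y, S y -> inner x y = 0].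

(* The value [z] is unique when [A] is densely defined. *)
Definition adjoint (H K : hilbertType R) (A : operator H K) : operator K H :=
  let is_adj y := [set z | forall x, dom A x -> inner (A x) y = inner x z] in
  Operator [set y | is_adj y !=set0] (fun y => xget 0 (is_adj y)).

Definition total_op (U V : Type) (f : U -> V) : operator U V :=
  Operator setT f.

Definition self_adjoint (H : hilbertType R) (A : operator H H) : Prop :=
  op_eq A (adjoint A).

Definition nonneg_op (H : hilbertType R) (A : operator H H) : Prop :=
  forall x, dom A x -> 0 <= inner (A x) x.

(* The state space of a semigroup is a linear subspace [S] of an ambient normed
   space, with the induced norm; [T t x] is irrelevant unless [0 <= t] and
   [S x]. *)
Record C0_semigroup (X : normedModType R[i]) (S : set X) (T : R -> X -> X) :
    Prop := {
  semigroup_maps : forall t, 0 <= t -> forall x, S x -> S (T t x) ;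
  semigroup_linear : forall t, 0 <= t -> linear_on S (T t) ;
  semigroup_bounded : forall t, 0 <= t -> bounded_on S (T t) ;
  semigroup0 : forall x, S x -> T 0 x = x ;
  semigroupD : forall s t, 0 <= s -> 0 <= t ->
    forall x, S x -> T (s + t) x = T s (T t x) ;
  semigroup_cvg0 : forall x, S x -> T t x @[t --> 0^'+] --> x }.

Definition generator (X : normedModType R[i]) (S : set X) (T : R -> X -> X) :
    operator X X :=
  let is_deriv x := [set y | S y /\
    (h%:C)^-1 *: (T h x - x) @[h --> 0^'+] --> y] in
  Operator [set x | S x /\ is_deriv x !=set0] (fun x => xget 0 (is_deriv x)).

Definition strongly_stable (X : normedModType R[i]) (S : set X)
    (T : R -> X -> X) : Prop :=
  forall x, S x -> (`|T t x| : R[i]^o) @[t --> +oo] --> (0 : R[i]^o).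

Definition semi_uniformly_stable (X : normedModType R[i]) (S : set X)
    (T : R -> X -> X) : Prop :=
  let G := generator S T in
  exists f : R -> R, (forall t, 0 <= t -> 0 <= f t) /\
    f t @[t --> +oo] --> (0 : R) /\
    forall x t, dom G x -> 0 <= t -> `|T t x| <= (f t)%:C * graph_norm G x.

Definition generates (X : normedModType R[i]) (S : set X) (A : operator X X)
    (T : R -> X -> X) : Prop :=
  C0_semigroup S T /\ op_eq (generator S T) A.

(* [H0 x ran(C)], as a subspace of [H0 x H1]. *)
Definition state_space (H0 H1 : hilbertType R) (C : operator H0 H1) :
    set (hprod H0 H1) :=
  [set z | ran C z.2].

(* [-(gamma 0; 0 0) - (0 -C^*; C 0)] on that space; only the restriction of
   [C^*] to [ran(C)] matters. *)
Definition damped_op (H0 H1 : hilbertType R) (C : operator H0 H1)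
    (gamma : H0 -> H0) : operator (hprod H0 H1) (hprod H0 H1) :=
  Operator
    [set z : hprod H0 H1 | dom C z.1 /\ dom (adjoint C) z.2 /\ ran C z.2]
    (fun z : hprod H0 H1 =>
       - hpair (gamma z.1) 0 - hpair (- adjoint C z.2) (C z.1)).

End Operators.

(* Main.v *)
Require Import Defs.
From HB Require Import structures.
From mathcomp Require Import all_boot all_order all_algebra complex.
From mathcomp Require Import all_classical all_reals all_analysis.
From mathcomp Require Import ring lra.
Set Implicit Arguments.
Unset Strict Implicit.
Unset Printing Implicit Defensive.
Import Order.TTheory GRing.Theory Num.Theory Num.Def.
Import numFieldNormedType.Exports.
Local Open Scope classical_set_scope.
Local Open Scope ring_scope.
Local Open Scope complex_scope.

(** The damping acts separately on two parts of [H0]. Choose an orthonormal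
    sequence [e_n] in the infinite-dimensional [ker C], and let [gamma] be the
    identity on [M = {e_n}^perp] and multiplication by [2^-n] along [e_n]. Each
    [(e_n, 0)] is then an eigenvector of the generator for the eigenvalue [-2^-n].
    These eigenvectors decay, but arbitrarily slowly, while their graph norms
    stay bounded: this rules out semi-uniform stability
    ([damped_not_semi_uniformly_stable]). On [M x ran C] the damping is complete.
    By compactness [C] is bounded below on [ker(C)^perp] ([bounded_below]), so
    [ran C] is closed and [C] has there a bounded right inverse [Q]; for small
    [eps] the form [|x|^2 + |y|^2 - 2 eps Re <x, Q y>] is a Lyapunov function,
    and orbits in [M x ran C] decay ([stable_damped]). The vectors [x] for which
    [(x, 0)] is stable form a closed subspace containing [M] and every [e_n], that
    is, all of [H0] ([damped_strongly_stable]).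

    Generation is the Lumer-Phillips theorem for a dissipative [A] such that
    [1 - h A] is onto for all [h > 0]. The semigroup is the limit of the backward
    Euler scheme [J_(t/n)^n], where [J_h = (1 - h A)^-1]. Everything rests on the
    estimate [|J_a J_b x - J_(a+b) x| <= a b |A^2 x|] ([resolvent_mul]): telescoped,
    it yields convergence of the scheme, the semigroup law, and the derivative
    at [0]. As a by-product, an inequality for one resolvent step, such as the
    Lyapunov inequality above, passes to the semigroup by iteration
    ([exp_decay]), without any differentiation along orbits.

    The resolvent equation itself, [x + h gamma x - h C^* y = f], [y + h C x = g],
    is the variational equation of a coercive symmetric form on the closed
    subspace [{(x, h C x)}] of the product space; it is solved by minimisation
    ([riesz_form]), which also gives orthogonal projections.

    Estimates are carried out with the real-valued norm [rnorm] and the real part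
    [rinner] of the scalar product, both with values in the ordered field [R]. *)

(** * Real norm and real scalar product *)

Section RealNorm.
Variables (R : realType) (V : normedModType R[i]).
Implicit Types (x y : V) (r : R).

Definition rnorm x : R := complex.Re `|x|.

Lemma rnormE x : `|x| = (rnorm x)%:C.
Proof. by rewrite /rnorm RRe_real // ger0_real. Qed.

Lemma rnorm_ge0 x : 0 <= rnorm x.
Proof. by rewrite -ler0c -rnormE. Qed.

Lemma rnorm0 : rnorm (0 : V) = 0.
Proof. by rewrite /rnorm normr0. Qed.

Lemma rnorm_eq0 x : rnorm x = 0 -> x = 0.
Proof. by move=> x0; apply/eqP; rewrite -normr_eq0 rnormE x0. Qed.

Lemma rnormN x : rnorm (- x) = rnorm x.
Proof. by rewrite /rnorm normrN. Qed.

Lemma rdistC x y : rnorm (x - y) = rnorm (y - x).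
Proof. by rewrite /rnorm distrC. Qed.

Lemma ler_rnormD x y : rnorm (x + y) <= rnorm x + rnorm y.
Proof. by rewrite -lecR rmorphD /= -!rnormE ler_normD. Qed.

Lemma ler_rdistD z x y : rnorm (x - y) <= rnorm (x - z) + rnorm (z - y).
Proof. by rewrite -lecR rmorphD /= -!rnormE ler_distD. Qed.

Lemma rnormZ r x : rnorm (r%:C *: x) = `|r| * rnorm x.
Proof.
by apply: complexI; rewrite rmorphM /= -!rnormE normrZ normc_def /= expr0n addr0 sqrtr_sqr.
Qed.

Lemma rnormZc (a : R[i]) x : rnorm (a *: x) = complex.Re `|a| * rnorm x.
Proof.
by apply: complexI; rewrite rmorphM /= -!rnormE normrZ.
Qed.

Lemma cvg_rnormP (T : Type) (F : set_system T) {FF : Filter F} (f : T -> V) (l : V) :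
  f @ F --> l <-> forall e : R, 0 < e -> \forall t \near F, rnorm (l - f t) < e.
Proof.
split => [/cvgrPdist_lt fl e e0|fl].
  have := fl e%:C; rewrite ltcR => /(_ e0).
  by apply: filterS => t; rewrite rnormE ltcR.
apply/cvgrPdist_lt => e e0.
have eE : e = (complex.Re e)%:C by rewrite RRe_real // gtr0_real.
move: e0; rewrite eE ltcR => e0; have := fl _ e0.
by apply: filterS => t; rewrite rnormE ltcR.
Qed.

Lemma cvg_rnorm (T : Type) (F : set_system T) {FF : Filter F} (f : T -> V) (l : V) :
  f @ F --> l -> rnorm (f t) @[t --> F] --> rnorm l.
Proof.
move=> /cvg_rnormP fl; apply/cvgrPdist_lt => e e0.
apply: filterS (fl _ e0) => t; apply: le_lt_trans.
have := ler_rdistD (f t) l 0; have := ler_rdistD l (f t) 0.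
rewrite !subr0 (rdistC (f t) l) => h1 h2.
by rewrite ler_norml; apply/andP; split; lra.
Qed.

Lemma cvg_rnorm_le (u : nat -> V) (l : V) (b : nat -> R) :
  (forall n, rnorm (l - u n) <= b n) -> b @ \oo --> 0 -> u @ \oo --> l.
Proof.
move=> ub /cvgrPdist_lt b0; apply/cvg_rnormP => e e0.
apply: filterS (b0 _ e0) => n; apply: le_lt_trans.
by rewrite sub0r normrN; apply: le_trans (ub n) (ler_norm _).
Qed.

End RealNorm.

Lemma cvg_rnorm_cauchy (R : realType) (V : completeNormedModType R[i])
    (u : nat -> V) :
  (forall e : R, 0 < e ->
    exists N, forall n, (N <= n)%N -> rnorm (u N - u n) < e) ->
  exists l : V, u @ \oo --> l.
Proof.
move=> uc; suff : cvg (u @ \oo) by move=> cu; exists (lim (u @ \oo)).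
apply: cauchy_cvg; apply: cauchy_exP => e e0.
have eE : e = (complex.Re e)%:C by rewrite RRe_real // gtr0_real.
move: e0; rewrite eE ltcR => /uc[N uN]; exists (u N).
suff: \forall n \near \oo, ball (u N) ((complex.Re e)%:C) (u n) by [].
near=> n; rewrite -ball_normE /ball_ /= rnormE ltcR.
by apply: uN; near: n; exact: nbhs_infty_ge.
Unshelve. all: by end_near. Qed.

Lemma cvg_rnorm_cauchy_rate (R : realType) (V : completeNormedModType R[i])
    (u : nat -> V) (b : nat -> R) : b @ \oo --> 0 ->
  (forall n m, (n <= m)%N -> rnorm (u n - u m) <= b n) ->
  exists l : V, u @ \oo --> l.
Proof.
move=> /cvgrPdist_lt b0 ub; apply: cvg_rnorm_cauchy => e /b0[N _ bN].
exists N => n Nn; apply: le_lt_trans (ub _ _ Nn) _.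
by apply: le_lt_trans (bN N _) => //=; rewrite sub0r normrN ler_norm.
Qed.

Section RealInner.
Variables (R : realType) (H : hilbertType R).
Implicit Types (x y z : H) (r : R).

Definition rinner x y : R := complex.Re (inner x y).

Lemma rinnerC x y : rinner x y = rinner y x.
Proof.
rewrite /rinner [inner x y]hermitian_subproof expr0 mul1r /=.
by case: (inner y x).
Qed.

Let ReD (a b : R[i]) : complex.Re (a + b) = complex.Re a + complex.Re b.
Proof. by case: a; case: b. Qed.

Let ReN (a : R[i]) : complex.Re (- a) = - complex.Re a.
Proof. by case: a. Qed.

Lemma rinnerDl x y z : rinner (x + y) z = rinner x z + rinner y z.
Proof. by rewrite /rinner linearDl ReD. Qed.

Lemma rinnerNl x z : rinner (- x) z = - rinner x z.
Proof. by rewrite /rinner linearNl ReN. Qed.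

Lemma rinnerBl x y z : rinner (x - y) z = rinner x z - rinner y z.
Proof. by rewrite rinnerDl rinnerNl. Qed.

Lemma rinnerZl r x z : rinner (r%:C *: x) z = r * rinner x z.
Proof.
rewrite /rinner linearZl_LR /=. case: (inner x z) => a b.
by rewrite /= mul0r subr0.
Qed.

Lemma rinnerDr x y z : rinner x (y + z) = rinner x y + rinner x z.
Proof. by rewrite rinnerC rinnerDl !(rinnerC _ x). Qed.

Lemma rinnerNr x z : rinner x (- z) = - rinner x z.
Proof. by rewrite rinnerC rinnerNl rinnerC. Qed.

Lemma rinnerBr x y z : rinner x (y - z) = rinner x y - rinner x z.
Proof. by rewrite rinnerDr rinnerNr. Qed.

Lemma rinnerZr r x z : rinner x (r%:C *: z) = r * rinner x z.
Proof. by rewrite rinnerC rinnerZl rinnerC. Qed.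

Lemma rinner0l x : rinner 0 x = 0.
Proof. by rewrite -(subrr x) rinnerBl subrr. Qed.

Lemma rinner0r x : rinner x 0 = 0.
Proof. by rewrite rinnerC rinner0l. Qed.

Definition rinnerE := (rinnerBl, rinnerBr, rinnerDl, rinnerDr, rinnerNl, rinnerNr,
  rinnerZl, rinnerZr).

Lemma rinnerxx x : rinner x x = rnorm x ^+ 2.
Proof. by rewrite /rinner -normsq_inner rnormE -rmorphXn. Qed.

Lemma rinner_ge0 x : 0 <= rinner x x.
Proof. by rewrite rinnerxx sqr_ge0. Qed.

Lemma rinner_eq0 x : rinner x x = 0 -> x = 0.
Proof. by rewrite rinnerxx => /eqP; rewrite sqrf_eq0 => /eqP/rnorm_eq0. Qed.

Lemma rcauchy_schwarz x y : `|rinner x y| <= rnorm x * rnorm y.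
Proof.
have [->|y0] := eqVneq y 0; first by rewrite rinner0r normr0 mulr_ge0 ?rnorm_ge0.
have Y0 : 0 < rnorm y.
  by rewrite lt_def rnorm_ge0 andbT; apply: contraNN y0 => /eqP/rnorm_eq0 ->.
have h := rinner_ge0 ((rnorm y ^+ 2)%:C *: x - (rinner x y)%:C *: y).
rewrite !rinnerE (rinnerC y x) !rinnerxx in h.
rewrite -ler_sqr ?nnegrE ?mulr_ge0 ?rnorm_ge0 // real_normK ?num_real // exprMn.
rewrite -subr_ge0 -(@pmulr_rge0 _ (rnorm y ^+ 2)) ?exprn_gt0 //.
by apply: le_trans h _; rewrite le_eqVlt; apply/orP; left; apply/eqP; ring.
Qed.

Lemma cvg_rinner (T : Type) (F : set_system T) {FF : Filter F} (f : T -> H) (l y : H) :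
  f @ F --> l -> rinner (f t) y @[t --> F] --> rinner l y.
Proof.
move=> /cvg_rnormP fl; apply/cvgrPdist_lt => e e0.
have Y0 : 0 < rnorm y + 1 by have := rnorm_ge0 y; lra.
apply: filterS (fl (e / (rnorm y + 1)) (divr_gt0 e0 Y0)) => t ht.
rewrite -rinnerBl; apply: le_lt_trans (rcauchy_schwarz _ _) _.
rewrite ltr_pdivlMr // in ht; apply: le_lt_trans ht.
by rewrite ler_wpM2l ?rnorm_ge0 // lerDl.
Qed.

End RealInner.

(** Testing against all complex multiples of [x] recovers the imaginary part,
    since [Re (i z) = - Im z]. *)
Lemma inner_eqP (R : realType) (H K : hilbertType R) (x y : H) (x' y' : K) :
  (forall a : R[i], rinner (a *: x) y = rinner (a *: x') y') ->
  inner x y = inner x' y'.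
Proof.
move=> h; have := h 1; have := h 'i; rewrite !scale1r /rinner !linearZl_LR /=.
case: (inner x y) (inner x' y') => [a b] [c d] /=.
by rewrite !mul0r !mul1r !sub0r => /oppr_inj -> ->.
Qed.

Lemma inner_sym0 (R : realType) (H : hilbertType R) (x y : H) :
  inner x y = 0 -> inner y x = 0.
Proof.
move=> xy; rewrite [LHS]hermitian_subproof expr0 mul1r.
by rewrite [X in conjC X](xy : inner x y = 0) rmorph0.
Qed.

Lemma inner_eq0 (R : realType) (H : hilbertType R) (x y : H) :
  (forall a : R[i], rinner x (a *: y) = 0) -> inner x y = 0.
Proof.
move=> xy; apply: inner_sym0; rewrite -(linear0l (inner : {dot H for _}) x).
by apply: inner_eqP => a; rewrite scaler0 rinner0l rinnerC.
Qed.

(** * Closed subspaces and the Riesz theorem *)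

Section Variational.
Variable R : realType.

(** The sequential form transfers between a graph in [U * V] and one in [hprod U V]
    without comparing the two topologies. *)
Definition seq_closed (V : normedModType R[i]) (S : set V) :=
  forall (u : nat -> V) l, (forall n, S (u n)) -> u @ \oo --> l -> S l.

Section Subspace.
Variables (V : lmodType R[i]) (S : set V).
Hypothesis S_sub : subspace_set S.

Lemma subspace0 : S 0. Proof. by case: S_sub. Qed.

Lemma subspaceD x y : S x -> S y -> S (x + y).
Proof. by case: S_sub => _ h Sx Sy; rewrite -[x]scale1r; exact: h. Qed.

Lemma subspaceZ a x : S x -> S (a *: x).
Proof. by case: S_sub => S0 h Sx; rewrite -[_ *: _]addr0; exact: h. Qed.

Lemma subspaceN x : S x -> S (- x).
Proof. by rewrite -scaleN1r; exact: subspaceZ. Qed.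

Lemma subspaceB x y : S x -> S y -> S (x - y).
Proof. by move=> Sx /subspaceN; exact: subspaceD. Qed.

End Subspace.

Lemma cvg_le0 (u b : nat -> R) (l : R) :
  u @ \oo --> l -> b @ \oo --> 0 -> (forall n, u n <= b n) -> l <= 0.
Proof.
move=> ul b0 ub; rewrite -subr_ge0.
have c : (b n - u n) @[n --> \oo] --> 0 - l by apply: cvgB.
apply: (cvgr_to_ge c).
by apply: nearW => n; rewrite subr_ge0.
Qed.

(** Minimise [a u u - 2 Re <w, u>] over [G]. By the parallelogram identity for [a]
    minimising sequences are Cauchy, and the first-order condition at the limit
    is the claim. With [a] the scalar product this is orthogonal projection;
    other forms yield the solution of the resolvent equation. *)
Lemma riesz_form (H : hilbertType R) (G : set H) (a : H -> H -> R) (w : H) :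
  subspace_set G -> seq_closed G ->
  (forall x y z, a (x + y) z = a x z + a y z) ->
  (forall (r : R) x z, a (r%:C *: x) z = r * a x z) ->
  (forall x y, a x y = a y x) ->
  (forall x, rnorm x ^+ 2 <= a x x) ->
  (forall z, exists K, forall x, a x z <= K * rnorm x) ->
  exists u, G u /\ forall v, G v -> a u v = rinner w v.
Proof.
move=> Gs Gc aDl aZl aC a_coer a_bd.
have aDr x y z : a z (x + y) = a z x + a z y by rewrite !(aC z) aDl.
have aZr (r : R) x z : a z (r%:C *: x) = r * a z x by rewrite !(aC z) aZl.
have NZ (x : H) : - x = (-1)%:C *: x by rewrite rmorphN rmorph1 scaleN1r.
pose phi u := a u u - 2 * rinner w u.
pose E := phi @` G.
have Elb : lbound E (- rnorm w ^+ 2).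
  move=> _ [u _ <-]; rewrite /phi.
  have := a_coer u; have := rcauchy_schwarz w u; rewrite ler_norml => /andP[_ h1] h2.
  have := sqr_ge0 (rnorm w - rnorm u); nra.
have Einf : has_inf E.
  split; last by exists (- rnorm w ^+ 2).
  by exists (phi 0), 0 => //; exact: subspace0.
set d := inf E.
have phi_ge u : G u -> d <= phi u.
  by move=> Gu; apply: ge_inf; [exists (- rnorm w ^+ 2)|exists u].
have h_gt0 n : 0 < harmonic n :> R by rewrite /harmonic /= invr_gt0 ltr0Sn.
have /choice[u uP] : forall n : nat, exists v, G v /\ phi v < d + harmonic n ^+ 2.
  move=> n; have [|_ [v Gv <-] h] := inf_adherent (eps := harmonic n ^+ 2) _ Einf.
    by rewrite exprn_gt0.
  by exists v.
have Gu n : G (u n) by have [] := uP n.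
have phiu n : phi (u n) < d + harmonic n ^+ 2 by have [] := uP n.
have b0 : (fun n => 2 * harmonic n : R) @ \oo --> 0.
  rewrite -(mulr0 2); apply: cvgMr; exact: cvg_harmonic.
have [n m nm|u0 u0P] := cvg_rnorm_cauchy_rate (u := u) b0.
  have hm : harmonic m <= harmonic n :> R.
    by rewrite /harmonic /= lef_pV2 ?posrE ?ltr0Sn // ler_nat ltnS.
  have Gm : G ((2^-1)%:C *: (u n + u m)).
    by apply: subspaceZ => //; apply: subspaceD.
  have /phi_ge := Gm; have := phiu n; have := phiu m.
  have := a_coer (u n - u m); rewrite /phi !NZ !rinnerE.
  rewrite !(aDl, aDr, aZl, aZr) (aC (u m)).
  move=> h1 h2 h3 h4.
  have hm2 : harmonic m ^+ 2 <= harmonic n ^+ 2 :> R.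
    by have := h_gt0 m; have := h_gt0 n; nra.
  have hn := h_gt0 n; rewrite -ler_sqr ?nnegrE ?rnorm_ge0 //; last by lra.
  by apply: le_trans h1 _; rewrite exprMn; lra.
exists u0; split; first exact: (Gc u).
have key v : G v -> a u0 v - rinner w v <= 0.
  move=> Gv; have [K aK] := a_bd v.
  have c1 : rnorm (u0 - u n) @[n --> \oo] --> 0.
    have c2 : u0 - u n @[n --> \oo] --> u0 - u0 by apply: cvgB => //; exact: cvg_cst.
    by rewrite -(rnorm0 H) -(subrr u0); exact: cvg_rnorm c2.
  have c3 : K * rnorm (u0 - u n) + (a v v + 1) / 2 * harmonic n @[n --> \oo] --> 0.
    have -> : 0 = K * 0 + (a v v + 1) / 2 * 0 by rewrite !mulr0 addr0.
    by apply: cvgD; apply: cvgMr => //; exact: cvg_harmonic.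
  apply: (cvg_le0 (u := fun _ => a u0 v - rinner w v) _ c3); first exact: cvg_cst.
  move=> n.
  (* the step [1/(n+1)] balances the defect [1/(n+1)^2] of [u n] from the infimum *)
  have Gn : G (u n + (- harmonic n)%:C *: v).
    by apply: subspaceD => //; apply: subspaceZ.
  have := phi_ge _ Gn; have := phiu n; have := aK (u0 - u n).
  rewrite /phi NZ !rinnerE !(aDl, aDr, aZl, aZr) (aC v) => h1 h2 h3.
  suff : a (u n) v - rinner w v <= (a v v + 1) / 2 * harmonic n by lra.
  rewrite -(ler_pM2r (h_gt0 n)).
  by set t := harmonic n in h_gt0 h2 h3 *; lra.
move=> v Gv; apply/eqP; rewrite eq_le -subr_le0 key //=.
have := key _ (subspaceN Gs Gv); rewrite NZ aZr rinnerZr; lra.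
Qed.

Lemma orth_proj (H : hilbertType R) (G : set H) (x : H) :
  subspace_set G -> seq_closed G ->
  exists p, G p /\ forall v, G v -> rinner (x - p) v = 0.
Proof.
move=> Gs Gc.
have [|||||p [Gp pP]] := riesz_form (a := @rinner R H) x Gs Gc.
- exact: rinnerDl.
- exact: rinnerZl.
- exact: rinnerC.
- by move=> y; rewrite rinnerxx.
- move=> z; exists (rnorm z) => y; rewrite mulrC.
  by apply: le_trans (rcauchy_schwarz _ _); exact: ler_norm.
by exists p; split=> // v Gv; rewrite rinnerBl pP // subrr.
Qed.

(** The residual of the projection of a point of [S] onto [G] is again in [S], so
    the hypothesis kills it. *)
Lemma subspace_total (H : hilbertType R) (G S : set H) :
  subspace_set G -> seq_closed G -> subspace_set S -> G `<=` S ->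
  (forall r, S r -> (forall v, G v -> rinner r v = 0) -> r = 0) -> S `<=` G.
Proof.
move=> Gs Gc Ss GS h x Sx; have [p [Gp pP]] := orth_proj x Gs Gc.
by have /eqP := h _ (subspaceB Ss Sx (GS _ Gp)) pP; rewrite subr_eq0 => /eqP ->.
Qed.

(** [subspace_total] for the closure of [D]. *)
Lemma orth_dense (H : hilbertType R) (D S : set H) :
  subspace_set D -> subspace_set S -> seq_closed S -> D `<=` S ->
  (forall r, S r -> (forall v, D v -> rinner r v = 0) -> r = 0) ->
  forall x, S x -> forall e : R, 0 < e -> exists y, D y /\ rnorm (x - y) < e.
Proof.
move=> Ds Ss Sc DS h.
pose G := [set x | S x /\ forall e : R, 0 < e -> exists y, D y /\ rnorm (x - y) < e].
suff hG : S `<=` G by move=> x /hG[].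
have DG : D `<=` G.
  move=> x Dx; split; first exact: DS.
  by move=> e e0; exists x; rewrite subrr rnorm0.
apply: subspace_total => //.
- split; first by apply: DG; exact: subspace0.
  move=> a x y [Sx hx] [Sy hy]; split; first by apply: subspaceD => //; exact: subspaceZ.
  move=> e e0; set k := complex.Re `|a|.
  have k0 : 0 <= k by have := normr_ge0 a; rewrite lecE => /andP[].
  have k1 : 0 < k + 1 by lra.
  have e2 : 0 < e / 2 by lra.
  have [x' [Dx' ex']] := hx _ (divr_gt0 e2 k1).
  have [y' [Dy' ey']] := hy _ e2.
  exists (a *: x' + y'); split; first by apply: subspaceD => //; exact: subspaceZ.
  rewrite opprD addrACA -scalerBr.
  apply: le_lt_trans (ler_rnormD _ _) _; rewrite rnormZc -/k.
  rewrite ltr_pdivlMr // in ex'; have := rnorm_ge0 (x - x'); nra.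
- move=> u l uG ul; split; first by apply: (Sc u) => // n; case: (uG n).
  move=> e e0; have e2 : 0 < e / 2 by lra.
  have /cvg_rnormP/(_ _ e2)[N _ uN] := ul.
  have [y [Dy ey]] := (uG N).2 _ e2; exists y; split=> //.
  apply: le_lt_trans (ler_rdistD (u N) _ _) _.
  by have := uN N (leqnn N); rewrite /=; lra.
- by move=> x [].
- by move=> r Sr rG; apply: h => // v /DG; exact: rG.
Qed.

End Variational.

(** * The Lumer-Phillips theorem by backward Euler *)

Section Iterates.
Variables (R : realType) (X : normedModType R[i]) (S : set X).

Definition nonexpansive_on (F : X -> X) :=
  forall x y, S x -> S y -> rnorm (F x - F y) <= rnorm (x - y).

Lemma iter_maps (F : X -> X) (E : set X) n x :
  (forall x, E x -> E (F x)) -> E x -> E (iter n F x).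
Proof. by move=> FE; elim: n x => //= n IH x Ex; exact/FE/IH. Qed.

Lemma iter_nonexpansive (F : X -> X) n :
  (forall x, S x -> S (F x)) -> nonexpansive_on F -> nonexpansive_on (iter n F).
Proof.
move=> FS Fn x y Sx Sy; elim: n => //= n IH.
by apply: le_trans (Fn _ _ _ _) IH; exact: iter_maps.
Qed.

(** A one-step error grows at most linearly with the number of steps when one of
    the two schemes is nonexpansive; the error is only required on a set [E]
    preserved by the other scheme. *)
Lemma iter_dist (F G : X -> X) (E : set X) (d : R) n x :
  (forall x, S x -> S (F x)) -> nonexpansive_on F -> E `<=` S ->
  (forall x, E x -> E (G x)) -> (forall x, E x -> rnorm (F x - G x) <= d) ->
  E x -> rnorm (iter n F x - iter n G x) <= n%:R * d.
Proof.
move=> FS Fn ES GE FG; elim: n x => [|n IH] x Ex.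
  by rewrite /= subrr rnorm0 mul0r.
rewrite !iterSr; apply: le_trans (ler_rdistD (iter n F (G x)) _ _) _.
rewrite mulrSr mulrDl mul1r addrC; apply: lerD; first exact/IH/GE.
apply: le_trans (FG _ Ex).
by apply: iter_nonexpansive => //; [exact/FS/ES|exact/ES/GE].
Qed.

End Iterates.

Section Resolvent.
Variables (R : realType) (X : hilbertType R).

(** The inverse of [1 - h A]. At [h = 0] it must be the identity on the whole space
    and not only on [dom A], hence the case distinction. *)
Definition resolvent (A : operator X X) (h : R) (z : X) : X :=
  if h == 0 then z else xget 0 [set u | dom A u /\ u - h%:C *: A u = z].

(** [n.+1] steps, so that the step size makes sense for every [n]. *)
Definition euler (A : operator X X) (t : R) (n : nat) (z : X) : X :=
  iter n.+1 (resolvent A (t / n.+1%:R)) z.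

Definition exp_op (A : operator X X) (t : R) (z : X) : X :=
  lim (euler A t n z @[n --> \oo]).

End Resolvent.

Section LumerPhillips.
Variables (R : realType) (X : hilbertType R) (S : set X) (A : operator X X).

Record m_dissipative_on : Prop := {
  mdiss_space : subspace_set S;
  mdiss_closed : seq_closed S;
  mdiss_linear : linear_op A;
  mdiss_dom : dom A `<=` S;
  mdiss_ran : forall x, dom A x -> S (A x);
  mdiss_diss : forall x, dom A x -> rinner (A x) x <= 0;
  mdiss_onto : forall (h : R) z, 0 < h -> S z ->
    exists u, dom A u /\ u - h%:C *: A u = z }.

Hypothesis A_md : m_dissipative_on.

Let Ss := mdiss_space A_md.
Let Sc := mdiss_closed A_md.
Let domS := mdiss_dom A_md.
Let Ds : subspace_set (dom A). Proof. by case: (mdiss_linear A_md). Qed.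
Let Alin : linear_on (dom A) A. Proof. by case: (mdiss_linear A_md). Qed.
Let J := resolvent A.
Let T := exp_op A.

Let A0 : A 0 = 0.
Proof.
have h := Alin (-1) (subspace0 Ds) (subspace0 Ds).
by rewrite !scaleN1r oppr0 addr0 addNr in h.
Qed.

Let AZ a x : dom A x -> A (a *: x) = a *: A x.
Proof. by move=> Dx; have := Alin a Dx (subspace0 Ds); rewrite A0 !addr0. Qed.

Let AB x y : dom A x -> dom A y -> A (x - y) = A x - A y.
Proof.
by move=> Dx Dy; have := Alin (-1) Dy Dx; rewrite !scaleN1r ![- _ + _]addrC.
Qed.

(** [|x|^2 <= Re <x - h A x, x>], as [Re <A x, x> <= 0]; then Cauchy-Schwarz. *)
Lemma dissipative_expansive (h : R) x : 0 <= h -> dom A x ->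
  rnorm x <= rnorm (x - h%:C *: A x).
Proof.
move=> h0 Dx; have d := mdiss_diss A_md Dx.
have := rcauchy_schwarz (x - h%:C *: A x) x; rewrite ler_norml => /andP[_].
rewrite !rinnerE rinnerxx => c.
have : rnorm x * rnorm x <= rnorm (x - h%:C *: A x) * rnorm x.
  by apply: le_trans c; rewrite expr2; nra.
have [->|x0] := eqVneq (rnorm x) 0; first by rewrite rnorm_ge0.
by rewrite ler_pM2r // lt_def x0 rnorm_ge0.
Qed.

Lemma resolventP (h : R) z : 0 < h -> S z ->
  dom A (J h z) /\ J h z - h%:C *: A (J h z) = z.
Proof.
move=> h0 Sz; rewrite /J /resolvent gt_eqF //.
by have /= := @xgetPex _ 0 _ (mdiss_onto A_md h0 Sz); apply.
Qed.

Lemma resolventK (h : R) x : 0 < h -> dom A x -> J h (x - h%:C *: A x) = x.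
Proof.
move=> h0 Dx; have Sx : S (x - h%:C *: A x).
  apply: subspaceB => //; first exact: domS.
  by apply: subspaceZ => //; exact: mdiss_ran.
have [D e] := resolventP h0 Sx.
set u := J h _ in D e *; apply/eqP; rewrite -subr_eq0; apply/eqP/rnorm_eq0.
apply: le_anti; rewrite rnorm_ge0 andbT.
apply: le_trans (dissipative_expansive (ltW h0) (subspaceB Ds D Dx)) _.
rewrite AB // (_ : _ - _ = (u - h%:C *: A u) - (x - h%:C *: A x)).
  by rewrite e subrr rnorm0.
by rewrite scalerBr !opprD addrACA.
Qed.

Lemma resolvent_maps (h : R) z : 0 <= h -> S z -> S (J h z).
Proof.
rewrite le_eqVlt => /predU1P[<-|h0] Sz; first by rewrite /J /resolvent eqxx.
by apply: domS; have [] := resolventP h0 Sz.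
Qed.

Lemma resolvent_linear (h : R) : 0 <= h -> linear_on S (J h).
Proof.
rewrite le_eqVlt => /predU1P[<- a x y _ _|h0 a x y Sx Sy].
  by rewrite /J /resolvent eqxx.
have [Dx ex] := resolventP h0 Sx; have [Dy ey] := resolventP h0 Sy.
have D : dom A (a *: J h x + J h y).
  by apply: subspaceD => //; exact: subspaceZ.
rewrite -(resolventK h0 D) Alin // -{1}ex -{1}ey; congr (J h _).
rewrite !(scalerBr, scalerDr) addrACA -opprD !scalerA.
by rewrite (mulrC a).
Qed.

Lemma resolventB (h : R) x y : 0 <= h -> S x -> S y -> J h (x - y) = J h x - J h y.
Proof.
move=> h0 Sx Sy; have := resolvent_linear h0 (-1) Sy Sx.
by rewrite !scaleN1r ![- _ + _]addrC.
Qed.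

Lemma resolvent_contr (h : R) z : 0 <= h -> S z -> rnorm (J h z) <= rnorm z.
Proof.
rewrite le_eqVlt => /predU1P[<-|h0] Sz; first by rewrite /J /resolvent eqxx.
have [D e] := resolventP h0 Sz.
by apply: le_trans (dissipative_expansive (ltW h0) D) _; rewrite e.
Qed.

Lemma resolvent_nonexpansive (h : R) : 0 <= h -> nonexpansive_on S (J h).
Proof.
move=> h0 x y Sx Sy; rewrite -resolventB //.
by apply: resolvent_contr => //; exact: subspaceB.
Qed.

Lemma resolvent_dom (h : R) x : 0 <= h -> dom A x ->
  dom A (J h x) /\ A (J h x) = J h (A x).
Proof.
rewrite le_eqVlt => /predU1P[<-|h0] Dx; first by rewrite /J /resolvent eqxx.
have [D e] := resolventP h0 (domS Dx); split=> //.
have h1 : h%:C != 0 :> R[i] by rewrite (inj_eq (@complexI R)) gt_eqF.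
have eA : A (J h x) = (h%:C)^-1 *: (J h x - x).
  by rewrite -{3}e opprB addrC subrK scalerA mulVf // scale1r.
have DA : dom A (A (J h x)) by rewrite eA; apply: subspaceZ => //; exact: subspaceB.
by rewrite -{2}e AB ?AZ ?resolventK //; exact: subspaceZ.
Qed.

Lemma resolvent_comm (a b : R) z : 0 <= a -> 0 <= b -> S z ->
  J a (J b z) = J b (J a z).
Proof.
move=> a0; rewrite le_eqVlt => /predU1P[<-|b0] Sz; first by rewrite /J /resolvent eqxx.
have [D e] := resolventP b0 Sz; have [D' e'] := resolvent_dom a0 D.
rewrite -{2}e resolventB //; last 2 first.
- exact: domS.
- by apply: subspaceZ => //; exact: mdiss_ran.
have -> : J a (b%:C *: A (J b z)) = b%:C *: J a (A (J b z)).
  have := resolvent_linear a0 b%:C (mdiss_ran A_md D) (subspace0 Ss).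
  rewrite !addr0 => ->; rewrite (_ : J a 0 = 0) ?addr0 //.
  apply: rnorm_eq0; apply: le_anti; rewrite rnorm_ge0 andbT -(rnorm0 X).
  by apply: resolvent_contr => //; exact: subspace0.
by rewrite -e' resolventK.
Qed.

(** The vectors on which the one-step error of the scheme is quadratic in the step
    size, with constant [c]. *)
Definition dom2 c := [set x | [/\ dom A x, dom A (A x) & rnorm (A (A x)) <= c]].

Lemma dom2_maps (h : R) c x : 0 <= h -> dom2 c x -> dom2 c (J h x).
Proof.
move=> h0 [D1 D2 xc]; have [D3 e3] := resolvent_dom h0 D1.
have [D4 e4] := resolvent_dom h0 D2.
split; rewrite ?e3 // e4; apply: le_trans xc.
by apply: resolvent_contr => //; exact: mdiss_ran.
Qed.

Lemma dom2_sub c : dom2 c `<=` S.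
Proof. by move=> x []/domS. Qed.

(** With [w = J_(a+b) x] one has
    [(1 - a A)(1 - b A) w = x + a b A^2 w], so that
    [w - J_a J_b x = a b J_a J_b A^2 w], and [A^2 w = J_(a+b) A^2 x]. *)
Lemma resolvent_mul (a b c : R) x : 0 <= a -> 0 <= b -> dom2 c x ->
  rnorm (J a (J b x) - J (a + b) x) <= a * b * c.
Proof.
move=> + + xc; have [D1 D2 c1] := xc.
have c0 : 0 <= c by apply: le_trans (rnorm_ge0 _) c1.
rewrite le_eqVlt => /predU1P[<- _|a0].
  by rewrite {1}/J /resolvent eqxx add0r subrr rnorm0 !mul0r.
rewrite le_eqVlt => /predU1P[<-|b0].
  by rewrite {2}/J /resolvent eqxx addr0 subrr rnorm0 mulr0 mul0r.
have ab0 : 0 < a + b by lra.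
have [Dw ew] := resolventP ab0 (domS D1).
have [Dw' Dw2 w2] := dom2_maps (ltW ab0) xc.
set w := J (a + b) x in Dw ew Dw' Dw2 w2 *.
have Sw : S w := domS Dw.
have SAw : S (A w) := domS Dw2.
have D3 : dom A (w - b%:C *: A w) by apply: subspaceB => //; exact: subspaceZ.
have e1 : w = J a (J b (x + (a * b)%:C *: A (A w))).
  have SAAw : S (A (A w)) by exact: mdiss_ran.
  rewrite resolvent_comm ?ltW //; last first.
    by apply: subspaceD => //; [exact: domS|exact: subspaceZ].
  rewrite (_ : _ + _ = (w - b%:C *: A w) - a%:C *: A (w - b%:C *: A w)).
    by rewrite !resolventK.
  rewrite AB //; last exact: subspaceZ.
  rewrite AZ // -{1}ew scalerBr scalerA -rmorphM rmorphD scalerDl.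
  by rewrite opprB opprD !addrA [w - _ - _]addrAC [LHS]addrAC.
have Sx : S x := domS D1.
have Sv : S ((a * b)%:C *: A (A w)) by apply: subspaceZ => //; exact: mdiss_ran.
have Sxv := subspaceD Ss Sx Sv.
have a1 := ltW a0; have b1 := ltW b0.
rewrite [X in _ - X]e1 -resolventB //; try exact: resolvent_maps.
rewrite -resolventB //.
have Sd := subspaceB Ss Sx Sxv.
apply: le_trans (resolvent_contr a1 (resolvent_maps b1 Sd)) _.
apply: le_trans (resolvent_contr b1 Sd) _.
rewrite opprD addrA subrr sub0r rnormN rnormZ ger0_norm ?mulr_ge0 //.
by rewrite ler_wpM2l // mulr_ge0.
Qed.

(** [m] small steps against one large step: add up [resolvent_mul] for the pairs
    [(h, j h)], [j < m]. *)
Lemma iter_resolvent_dist (h : R) m c x : 0 <= h -> dom2 c x ->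
  rnorm (iter m (J h) x - J (m%:R * h) x) <= (m%:R * h) ^+ 2 * c.
Proof.
move=> h0 xc; have c0 : 0 <= c by case: xc => _ _; apply: le_trans (rnorm_ge0 _).
have Sx := dom2_sub xc.
elim: m => [|m IH]; first by rewrite /= mul0r /J /resolvent eqxx subrr rnorm0 expr0n mul0r.
have hE : m.+1%:R * h = h + m%:R * h by rewrite mulrS mulrDl mul1r.
rewrite hE iterS; apply: le_trans (ler_rdistD (J h (J (m%:R * h) x)) _ _) _.
have mh0 : 0 <= m%:R * h by rewrite mulr_ge0.
have Sm : S (iter m (J h) x) by apply: iter_maps Sx => y; exact: resolvent_maps.
apply: le_trans (lerD (resolvent_nonexpansive h0 Sm (resolvent_maps mh0 Sx))
  (resolvent_mul h0 mh0 xc)) _.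
apply: le_trans (lerD IH (lexx _)) _.
rewrite -mulrDl ler_wpM2r //; nra.
Qed.

Lemma euler_refine (t : R) n m c x : 0 <= t -> dom2 c x -> (0 < n)%N -> (0 < m)%N ->
  rnorm (iter (n * m) (J (t / (n * m)%:R)) x - iter n (J (t / n%:R)) x) <=
  t ^+ 2 * c / n%:R.
Proof.
move=> t0 xc n0 m0.
have nR : n%:R != 0 :> R by rewrite pnatr_eq0 -lt0n.
have mR : m%:R != 0 :> R by rewrite pnatr_eq0 -lt0n.
have h0 : 0 <= t / (n * m)%:R by rewrite divr_ge0.
have k0 : 0 <= t / n%:R by rewrite divr_ge0.
have e : m%:R * (t / (n * m)%:R) = t / n%:R by rewrite natrM; field; rewrite nR mR.
have -> : t ^+ 2 * c / n%:R = n%:R * ((t / n%:R) ^+ 2 * c) by field.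
rewrite iterM; apply: (iter_dist (S := S) (E := dom2 c)) => //.
- by move=> y; apply: iter_maps => z; exact: resolvent_maps.
- apply: iter_nonexpansive; first by move=> z; exact: resolvent_maps.
  exact: resolvent_nonexpansive.
- exact: dom2_sub.
- by move=> y; exact: dom2_maps.
- by move=> y yc; rewrite -e; exact: iter_resolvent_dist.
Qed.

(** Both schemes are compared with the common refinement of their time grids. *)
Lemma euler_dist (t : R) n m c x : 0 <= t -> dom2 c x ->
  rnorm (euler A t n x - euler A t m x) <= t ^+ 2 * c * (harmonic n + harmonic m).
Proof.
move=> t0 xc; apply: le_trans (ler_rdistD (iter (n.+1 * m.+1) (J (t / (n.+1 * m.+1)%:R)) x) _ _) _.
rewrite mulrDr; apply: lerD; first by rewrite rdistC; exact: euler_refine.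
by rewrite mulnC; exact: euler_refine.
Qed.

(** Let [r] be orthogonal to [dom A] and write [r = u - A u]. Then
    [|u|^2 = Re <A u, u> <= 0], hence [u = 0] and [r = 0]. *)
Lemma dom_dense_in x e : S x -> 0 < e -> exists y, dom A y /\ rnorm (x - y) < e.
Proof.
move=> Sx e0; apply: (@orth_dense _ _ (dom A) S) => //.
move=> r Sr rD; have [Du eu] := resolventP ltr01 Sr.
set u := J 1 r in Du eu; rewrite rmorph1 scale1r in eu.
suff u0 : u = 0 by rewrite -eu u0 A0 subrr.
apply: rinner_eq0; apply: le_anti; rewrite rinner_ge0 andbT.
have := rD _ Du; rewrite -{1}eu rinnerBl => /eqP; rewrite subr_eq0 => /eqP ->.
exact: mdiss_diss.
Qed.

Lemma resolvent_approx (h : R) x : 0 <= h -> dom A x -> rnorm (J h x - x) <= h * rnorm (A x).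
Proof.
rewrite le_eqVlt => /predU1P[<-|h0] Dx.
  by rewrite /J /resolvent eqxx subrr rnorm0 mul0r.
have [D e] := resolventP h0 (domS Dx); have [_ e'] := resolvent_dom (ltW h0) Dx.
have -> : J h x - x = h%:C *: A (J h x) by rewrite -{2}e opprB addrC subrK.
rewrite rnormZ (ger0_norm (ltW h0)) (ler_wpM2l (ltW h0)) // e'.
by apply: resolvent_contr; [exact: ltW|exact: mdiss_ran].
Qed.

(** Strong convergence of [J_h] to the identity; it makes [dom2] a core of [A]. *)
Lemma resolvent_cvg z e : S z -> 0 < e -> exists h, 0 < h /\ rnorm (z - J h z) < e.
Proof.
move=> Sz e0; have e3 : 0 < e / 3 by lra.
have [y [Dy ey]] := dom_dense_in Sz e3.
have k1 : 0 < rnorm (A y) + 1 by have := rnorm_ge0 (A y); lra.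
have h0 := divr_gt0 e3 k1; exists (e / 3 / (rnorm (A y) + 1)); split=> //.
set h := e / 3 / _ in h0 *.
apply: le_lt_trans (ler_rdistD y _ _) _.
apply: le_lt_trans (lerD (lexx _) (ler_rdistD (J h y) _ _)) _.
have h1 := resolvent_approx (ltW h0) Dy; rewrite rdistC in h1.
have h2 := resolvent_nonexpansive (ltW h0) (domS Dy) Sz; rewrite (rdistC y) in h2.
have h3 : h * (rnorm (A y) + 1) = e / 3 by rewrite /h divfK // gt_eqF.
rewrite mulrDr mulr1 in h3; lra.
Qed.

Lemma dom2_dense x e : S x -> 0 < e ->
  exists c y, dom2 c y /\ rnorm (x - y) < e.
Proof.
move=> Sx e0; have e2 : 0 < e / 2 by lra.
have [y [Dy ey]] := dom_dense_in Sx e2.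
have [h [h0 eh]] := resolvent_cvg (domS Dy) e2.
have [D e'] := resolvent_dom (ltW h0) Dy.
exists (rnorm (A (A (J h y)))), (J h y); split.
  by split=> //; rewrite e'; have [] := resolventP h0 (mdiss_ran A_md Dy).
by apply: le_lt_trans (ler_rdistD y _ _) _; lra.
Qed.

Lemma euler_maps (t : R) n x : 0 <= t -> S x -> S (euler A t n x).
Proof.
by move=> t0; apply: iter_maps => y; apply: resolvent_maps; rewrite divr_ge0.
Qed.

Lemma euler_nonexpansive (t : R) n : 0 <= t -> nonexpansive_on S (euler A t n).
Proof.
move=> t0; apply: iter_nonexpansive; first by move=> y; apply: resolvent_maps; rewrite divr_ge0.
by apply: resolvent_nonexpansive; rewrite divr_ge0.
Qed.

Lemma euler_cvg (t : R) x : 0 <= t -> S x -> euler A t n x @[n --> \oo] --> T t x.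
Proof.
move=> t0 Sx; suff [l ul] : exists l : X, euler A t n x @[n --> \oo] --> l.
  by rewrite /T /exp_op; apply/cvg_ex; exists l.
apply: cvg_rnorm_cauchy => e e0; have e3 : 0 < e / 3 by lra.
have [c [y [yc xy]]] := dom2_dense Sx e3.
have : t ^+ 2 * c * harmonic n @[n --> \oo] --> (0 : R).
  by rewrite -(mulr0 (t ^+ 2 * c)); apply: cvgMr; exact: cvg_harmonic.
have e6 : 0 < e / 6 by lra.
move=> /cvgrPdist_lt/(_ _ e6)[N _ hN]; exists N => n Nn.
apply: le_lt_trans (ler_rdistD (euler A t N y) _ _) _.
have h1 := euler_nonexpansive N t0 Sx (dom2_sub yc).
have h2 := euler_nonexpansive n t0 (dom2_sub yc) Sx.
have h3 := euler_dist N n t0 yc; rewrite mulrDr in h3.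
have h4 := hN N (leqnn N); have h5 := hN n Nn; rewrite /= !sub0r !normrN in h4 h5.
have h6 := ler_norm (t ^+ 2 * c * harmonic n).
have h7 := ler_norm (t ^+ 2 * c * harmonic N).
apply: le_lt_trans (lerD (lexx _) (ler_rdistD (euler A t n y) _ _)) _.
rewrite (rdistC y) in h2; lra.
Qed.

Lemma exp_maps (t : R) x : 0 <= t -> S x -> S (T t x).
Proof.
by move=> t0 Sx; apply: (Sc _ (euler_cvg t0 Sx)) => n; exact: euler_maps.
Qed.

Lemma exp_lim (t : R) x l : 0 <= t -> S x ->
  euler A t n x @[n --> \oo] --> l -> T t x = l.
Proof. by move=> t0 Sx; apply: (cvg_unique _ (euler_cvg t0 Sx)); exact: norm_hausdorff. Qed.

Lemma iter_linear_on (F : X -> X) n :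
  (forall x, S x -> S (F x)) -> linear_on S F -> linear_on S (iter n F).
Proof.
move=> FS Fl a x y Sx Sy; elim: n => //= n ->; apply: Fl; exact: iter_maps.
Qed.

Lemma exp_linear (t : R) : 0 <= t -> linear_on S (T t).
Proof.
move=> t0 a x y Sx Sy; apply: exp_lim => //.
  by apply: subspaceD => //; exact: subspaceZ.
have k0 n : 0 <= t / n.+1%:R by rewrite divr_ge0.
have -> : (fun n => euler A t n (a *: x + y)) =
          (fun n => a *: euler A t n x + euler A t n y).
  apply/funext => n; apply: iter_linear_on => //.
    by move=> z; apply: resolvent_maps.
  exact: resolvent_linear.
by apply: cvgD; [apply: cvgZr|]; exact: euler_cvg.
Qed.

Lemma expB (t : R) x y : 0 <= t -> S x -> S y -> T t (x - y) = T t x - T t y.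
Proof.
move=> t0 Sx Sy; have := exp_linear t0 (-1) Sy Sx.
by rewrite !scaleN1r ![- _ + _]addrC.
Qed.

Lemma exp_bound (F : X -> X) (t : R) x y b : 0 <= t -> S x ->
  (forall n, rnorm (euler A t n x - y) <= b) -> rnorm (T t x - y) <= b.
Proof.
move=> t0 Sx h; have c : euler A t n x - y @[n --> \oo] --> T t x - y.
  by apply: cvgB; [exact: euler_cvg|exact: cvg_cst].
by apply: (cvgr_to_le (cvg_rnorm c)); exact: nearW.
Qed.

Lemma exp_contr (t : R) x : 0 <= t -> S x -> rnorm (T t x) <= rnorm x.
Proof.
move=> t0 Sx; rewrite -[T t x]subr0; apply: exp_bound => // n; rewrite subr0.
have k0 : 0 <= t / n.+1%:R by rewrite divr_ge0.
rewrite /euler; move: (_ / _) k0 => k k0; elim: n.+1 => // m IH; rewrite iterS; apply: le_trans IH.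
by apply: resolvent_contr => //; apply: iter_maps Sx => y; exact: resolvent_maps.
Qed.

Lemma exp_nonexpansive (t : R) : 0 <= t -> nonexpansive_on S (T t).
Proof.
by move=> t0 x y Sx Sy; rewrite -expB //; apply: exp_contr => //; exact: subspaceB.
Qed.

Lemma exp_resolvent (t : R) c x : 0 <= t -> dom2 c x ->
  rnorm (T t x - J t x) <= t ^+ 2 * c.
Proof.
move=> t0 xc; apply: exp_bound => // [|n]; first exact: dom2_sub xc.
have tE : n.+1%:R * (t / n.+1%:R) = t by rewrite mulrC divfK // pnatr_eq0.
have k0 : 0 <= t / n.+1%:R by rewrite divr_ge0.
by have := iter_resolvent_dist n.+1 k0 xc; rewrite tE.
Qed.

Lemma exp_increment (t : R) x : 0 <= t -> dom A x ->
  rnorm (T t x - x) <= t * rnorm (A x).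
Proof.
move=> t0 Dx; apply: exp_bound => // [|n]; first exact: domS.
have k0 : 0 <= t / n.+1%:R by rewrite divr_ge0.
have tE : n.+1%:R * (t / n.+1%:R * rnorm (A x)) = t * rnorm (A x).
  by rewrite mulrA [_ * (t / _)]mulrC divfK // pnatr_eq0.
have idE m : iter m id x = x by elim: m.
rewrite -tE -{2}(idE n.+1) /euler.
apply: (iter_dist (S := S) (E := [set y | dom A y /\ rnorm (A y) <= rnorm (A x)])) => //.
- by move=> y; exact: resolvent_maps.
- exact: resolvent_nonexpansive.
- by move=> y [/domS].
- by move=> y [Dy yx]; apply: le_trans (resolvent_approx k0 Dy) _; exact: ler_wpM2l.
Qed.

Lemma exp0 x : S x -> T 0 x = x.
Proof.
move=> Sx; apply: exp_lim => //; rewrite (_ : (fun n => _) = fun=> x); first exact: cvg_cst.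
apply/funext => n; rewrite /euler mul0r; elim: n.+1 => //= m ->.
by rewrite /resolvent eqxx.
Qed.

Lemma iter_resolvent_comp (a b : R) n x : 0 <= a -> 0 <= b -> S x ->
  iter n (J a \o J b) x = iter n (J a) (iter n (J b) x).
Proof.
move=> a0 b0 Sx.
have iS k m y : 0 <= k -> S y -> S (iter m (J k) y).
  by move=> k0; apply: iter_maps => z; exact: resolvent_maps.
have comm m y : S y -> J b (iter m (J a) y) = iter m (J a) (J b y).
  by move=> Sy; elim: m => //= m <-; apply: resolvent_comm => //; exact: iS.
by elim: n => //= n ->; rewrite comm //; exact: iS.
Qed.

(** The schemes for [s] and [t] run together differ from the scheme for [s + t] by
    the one-step error of [resolvent_mul]. *)
Lemma euler_mul (s t : R) n c x : 0 <= s -> 0 <= t -> dom2 c x ->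
  rnorm (euler A (s + t) n x - euler A s n (euler A t n x)) <= s * t * c * harmonic n.
Proof.
move=> s0 t0 xc; rewrite rdistC /euler.
have k0 (r : R) : 0 <= r -> 0 <= r / n.+1%:R by move=> ?; rewrite divr_ge0.
rewrite -iter_resolvent_comp ?k0 //; last exact: dom2_sub xc.
have -> : s * t * c * harmonic n = n.+1%:R * (s / n.+1%:R * (t / n.+1%:R) * c).
  have : n.+1%:R != 0 :> R by rewrite pnatr_eq0.
  by rewrite /harmonic /=; move: n.+1%:R => k k1; field.
apply: (iter_dist (S := S) (E := dom2 c)) => //.
- by move=> y Sy /=; do 2![apply: resolvent_maps; rewrite ?k0 //].
- move=> y z Sy Sz /=.
  have [Sy' Sz'] := (resolvent_maps (k0 _ t0) Sy, resolvent_maps (k0 _ t0) Sz).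
  apply: le_trans (resolvent_nonexpansive (k0 _ s0) Sy' Sz') _.
  exact: resolvent_nonexpansive (k0 _ t0) _ _ Sy Sz.
- exact: dom2_sub.
- by move=> y; apply: dom2_maps; rewrite k0 // addr_ge0.
- by move=> y yc /=; rewrite mulrDl; apply: resolvent_mul; rewrite ?k0.
Qed.

(** The inner argument may be moved to its limit since the outer scheme is
    nonexpansive. *)
Lemma exp_comp_cvg (s t : R) x : 0 <= s -> 0 <= t -> S x ->
  euler A s n (euler A t n x) @[n --> \oo] --> T s (T t x).
Proof.
move=> s0 t0 Sx; have STx := exp_maps t0 Sx.
have c1 : euler A s n (T t x) @[n --> \oo] --> T s (T t x) by exact: euler_cvg.
have c2 : euler A t n x - T t x @[n --> \oo] --> T t x - T t x.
  by apply: cvgB; [exact: euler_cvg|exact: cvg_cst].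
have c3 : rnorm (euler A t n x - T t x) @[n --> \oo] --> 0.
  by rewrite -(rnorm0 X) -(subrr (T t x)); exact: cvg_rnorm c2.
have c4 : euler A s n (T t x) - euler A s n (euler A t n x) @[n --> \oo] --> 0.
  apply: (cvg_rnorm_le _ c3) => n; rewrite sub0r rnormN (rdistC _ (T t x)).
  by apply: euler_nonexpansive => //; exact: euler_maps.
rewrite -(subr0 (T s _)); have -> : (fun n => euler A s n (euler A t n x)) =
    (fun n => euler A s n (T t x) - (euler A s n (T t x) - euler A s n (euler A t n x))).
  by apply/funext => n; rewrite subKr.
exact: cvgB.
Qed.

Lemma expD (s t : R) x : 0 <= s -> 0 <= t -> S x -> T (s + t) x = T s (T t x).
Proof.
move=> s0 t0 Sx; have st0 : 0 <= s + t by rewrite addr_ge0.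
have on2 c y : dom2 c y -> T (s + t) y = T s (T t y).
  move=> yc; have Sy := dom2_sub yc.
  apply/eqP; rewrite -subr_eq0; apply/eqP/rnorm_eq0/le_anti; rewrite rnorm_ge0 andbT.
  have c1 : euler A (s + t) n y - euler A s n (euler A t n y) @[n --> \oo]
      --> T (s + t) y - T s (T t y).
    by apply: cvgB; [exact: euler_cvg|exact: exp_comp_cvg].
  apply: (cvg_le0 (cvg_rnorm c1) (b := fun n => s * t * c * harmonic n)).
    by rewrite -(mulr0 (s * t * c)); apply: cvgMr; exact: cvg_harmonic.
  by move=> n; exact: euler_mul.
apply/eqP; rewrite -subr_eq0; apply/eqP/rnorm_eq0/le_anti; rewrite rnorm_ge0 andbT.
apply/ler_addgt0Pl => e e0; rewrite addr0; have e2 : 0 < e / 2 by lra.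
have [c [y [yc xy]]] := dom2_dense Sx e2; have Sy := dom2_sub yc.
apply: le_trans (ler_rdistD (T (s + t) y) _ _) _.
have h1 := exp_nonexpansive st0 Sx Sy.
have h2 : rnorm (T (s + t) y - T s (T t x)) <= rnorm (y - x).
  rewrite (on2 _ _ yc); apply: le_trans (exp_nonexpansive s0 _ _) _; try exact: exp_maps.
  exact: exp_nonexpansive.
rewrite (rdistC y) in h2; lra.
Qed.

Lemma exp_cvg0 x : S x -> T t x @[t --> 0^'+] --> x.
Proof.
move=> Sx; apply/cvg_rnormP => e e0; have e3 : 0 < e / 3 by lra.
have [y [Dy xy]] := dom_dense_in Sx e3.
have k1 : 0 < rnorm (A y) + 1 by have := rnorm_ge0 (A y); lra.
near=> t; have t0 : 0 < t by [].
have td : t < e / 3 / (rnorm (A y) + 1).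
  by near: t; apply: nbhs_right_lt; exact: divr_gt0.
rewrite ltr_pdivlMr // in td.
have h1 := exp_increment (ltW t0) Dy.
have h2 := exp_nonexpansive (ltW t0) (domS Dy) Sx.
apply: le_lt_trans (ler_rdistD y _ _) _.
apply: le_lt_trans (lerD (lexx _) (ler_rdistD (T t y) _ _)) _.
rewrite (rdistC y (T t y)); rewrite (rdistC y x) in h2; lra.
Unshelve. all: by end_near. Qed.

Theorem exp_C0 : C0_semigroup S T.
Proof.
split.
- by move=> t t0 x; exact: exp_maps.
- exact: exp_linear.
- move=> t t0; exists 1 => x Sx; rewrite mul1r !rnormE lecR; exact: exp_contr.
- exact: exp0.
- by move=> s t s0 t0 x Sx; exact: expD.
- exact: exp_cvg0.
Qed.

Let rderiv (x y : X) : Prop := (h%:C)^-1 *: (T h x - x) @[h --> 0^'+] --> y.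

Let rnorm_quot (h : R) (v : X) : 0 < h -> rnorm ((h%:C)^-1 *: v) = rnorm v / h.
Proof.
by move=> h0; rewrite -fmorphV rnormZ ger0_norm ?invr_ge0 ?ltW // mulrC.
Qed.

(** [T_h x] is [J_h x] up to [O(h^2)], and [(J_h x - x) / h = J_h A x]. *)
Let rderiv_dom2 c x h : dom2 c x -> 0 < h ->
  rnorm (A x - (h%:C)^-1 *: (T h x - x)) <= 2 * h * c.
Proof.
move=> xc h0; have [D1 D2 c1] := xc; have Sx := domS D1.
have h1 : h%:C != 0 :> R[i] by rewrite (inj_eq (@complexI R)) gt_eqF.
have -> : A x - (h%:C)^-1 *: (T h x - x) = (A x - J h (A x)) - (h%:C)^-1 *: (T h x - J h x).
  have [D e] := resolventP h0 Sx; have [_ e'] := resolvent_dom (ltW h0) D1.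
  have -> : T h x - x = (T h x - J h x) + h%:C *: J h (A x).
    by rewrite -{2}e e' opprB addrA addrAC.
  by rewrite scalerDr scalerA mulVf // scale1r opprD addrA addrAC.
apply: le_trans (ler_rnormD _ _) _; rewrite rnormN rnorm_quot // rdistC.
have a1 := resolvent_approx (ltW h0) D2.
have a2 := exp_resolvent (ltW h0) xc.
have a3 : rnorm (T h x - J h x) / h <= h * c by rewrite ler_pdivrMr //; lra.
have a4 : h * rnorm (A (A x)) <= h * c by rewrite ler_pM2l.
lra.
Qed.

(** Replace [x] by [x' = J_d x] with [A x' = J_d A x] close to [A x], on which
    [rderiv_dom2] applies; the difference quotient at [x - x'] is bounded by
    [|A (x - x')|] through [exp_increment]. *)
Let rderiv_dom x : dom A x -> rderiv x (A x).
Proof.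
move=> Dx; apply/cvg_rnormP => e e0; have e3 : 0 < e / 4 by lra.
have [d [d0 ed]] := resolvent_cvg (mdiss_ran A_md Dx) e3.
have [Dd eAd] := resolvent_dom (ltW d0) Dx; set x' := J d x in Dd eAd.
rewrite -eAd in ed; set c := rnorm (A (A x')).
have x'c : dom2 c x'.
  by split=> //; rewrite eAd; have [] := resolventP d0 (mdiss_ran A_md Dx).
have c0 : 0 < 8 * (c + 1) by have : 0 <= c := rnorm_ge0 _; lra.
have Dw : dom A (x - x') by exact: subspaceB.
near=> h; have h0 : 0 < h by [].
have hd : h < e / (8 * (c + 1)).
  by near: h; apply: nbhs_right_lt; exact: divr_gt0.
rewrite ltr_pdivlMr // in hd.
have h1 := rderiv_dom2 x'c h0.
have h2 : rnorm ((h%:C)^-1 *: (T h (x - x') - (x - x'))) < e / 4.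
  rewrite rnorm_quot // ltr_pdivrMr //.
  apply: le_lt_trans (exp_increment (ltW h0) Dw) _.
  by rewrite AB // mulrC ltr_pM2r.
have -> : A x - (h%:C)^-1 *: (T h x - x) = (A x - A x') +
    ((A x' - (h%:C)^-1 *: (T h x' - x')) - (h%:C)^-1 *: (T h (x - x') - (x - x'))).
  have -> : T h x - x = (T h x' - x') + (T h (x - x') - (x - x')).
    have -> : T h (x - x') = T h x - T h x' by apply: expB; [exact: ltW|exact: domS..].
    by rewrite addrACA -opprD !(subrKC, subrK).
  by rewrite scalerDr opprD !addrA subrK.
apply: le_lt_trans (ler_rnormD _ _) _.
apply: le_lt_trans (lerD (lexx _) (ler_rnormD _ _)) _; rewrite rnormN; nra.
Unshelve. all: by end_near. Qed.

Let rderiv_diss x y : S x -> rderiv x y -> rinner y x <= 0.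
Proof.
move=> Sx xy.
have c : rinner ((h%:C)^-1 *: (T h x - x)) x @[h --> 0^'+] --> rinner y x.
  exact: cvg_rinner.
apply: (cvgr_to_le c); near=> h; have h0 : 0 < h by [].
rewrite -fmorphV rinnerZl pmulr_rle0 ?invr_gt0 // rinnerBl subr_le0 rinnerxx.
apply: le_trans (ler_norm _) _; apply: le_trans (rcauchy_schwarz _ _) _.
by rewrite expr2 ler_wpM2r ?rnorm_ge0 // exp_contr // ltW.
Unshelve. all: by end_near. Qed.

Let rderivB x y x' y' : S x -> S x' -> rderiv x y -> rderiv x' y' -> rderiv (x - x') (y - y').
Proof.
move=> Sx Sx' xy xy'.
have c : (h%:C)^-1 *: (T h x - x) - (h%:C)^-1 *: (T h x' - x') @[h --> 0^'+] --> y - y'.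
  exact: cvgB.
apply: cvg_trans c; apply: near_eq_cvg; near=> h; have h0 : 0 < h by [].
rewrite -scalerBr; congr (_ *: _).
have -> : T h (x - x') = T h x - T h x' by apply: expB => //; exact: ltW.
by rewrite !opprD addrACA.
Unshelve. all: by end_near. Qed.

(** The generator extends [A] by [rderiv_dom] and is dissipative because [T] is
    contractive. Since [1 - A] is already onto [S] and [1 - G] is injective for
    a dissipative [G], the extension is not proper. *)
Theorem exp_generator : op_eq (generator S T) A.
Proof.
have derivA x y : S x -> S y -> rderiv x y -> dom A x /\ A x = y.
  move=> Sx Sy xy.
  have [Dz ez] := resolventP ltr01 (subspaceB Ss Sx Sy).
  set z := J 1 _ in Dz ez; rewrite rmorph1 scale1r in ez.
  have Sz := domS Dz.
  have zE : A z = z - (x - y) by rewrite -ez subKr.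
  have := rderiv_diss (subspaceB Ss Sx Sz) (rderivB Sx Sz xy (rderiv_dom Dz)).
  have -> : y - A z = x - z by rewrite zE opprB addrA subrKC.
  move=> h; have /eqP : x - z = 0 by apply/rinner_eq0/le_anti; rewrite h rinner_ge0.
  rewrite subr_eq0 => /eqP xz; rewrite xz; split=> //.
  by rewrite zE xz subKr.
have uniq x y y' : rderiv x y -> rderiv x y' -> y = y'.
  by apply: cvg_unique; exact: norm_hausdorff.
have Aderiv x : dom A x -> S (A x) /\ rderiv x (A x).
  by move=> Dx; split; [exact: mdiss_ran|exact: rderiv_dom].
split; first apply/seteqP; first split.
- by move=> x [Sx [y [Sy xy]]]; have [] := derivA _ _ Sx Sy xy.
- by move=> x Dx; split; [exact: domS|exists (A x); exact: Aderiv].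
move=> x [Sx ex]; rewrite /generator /=.
by case: xgetP => [y _ [Sy xy]|/(_ _)]; [have [] := derivA _ _ Sx Sy xy|case: ex => y hy /(_ y)].
Qed.

(** A Lyapunov inequality for one resolvent step iterates to
    [(1 + k w)^n q(J_k^n z) <= q z], and Bernoulli bounds the factor below by
    [1 + n k w], which is [1 + t w] along the scheme. The limit is taken in the
    norm, through the lower bound on [q]. *)
Lemma exp_decay (D : set X) (q : X -> R) (m w : R) :
  0 < m -> 0 <= w -> D `<=` S ->
  (forall h z, 0 < h -> D z -> D (J h z) /\ (1 + h * w) * q (J h z) <= q z) ->
  (forall z, D z -> m * rnorm z ^+ 2 <= q z) ->
  forall t z, 0 <= t -> D z -> m * rnorm (T t z) ^+ 2 <= q z / (1 + t * w).
Proof.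
move=> m0 w0 DS Dq qm t z; rewrite le_eqVlt => /predU1P[<-|t0] Dz.
  by rewrite exp0 ?mul0r ?addr0 ?divr1; [exact: qm|exact: DS].
have tw : 0 < 1 + t * w by have := mulr_ge0 (ltW t0) w0; lra.
have q0 y : D y -> 0 <= q y.
  by move=> Dy; apply: le_trans (qm _ Dy); rewrite mulr_ge0 ?sqr_ge0 // ltW.
have bd n : m * rnorm (euler A t n z) ^+ 2 <= q z / (1 + t * w).
  have k0 : 0 < t / n.+1%:R by rewrite divr_gt0.
  have kE : n.+1%:R * (t / n.+1%:R) = t by rewrite mulrC divfK // pnatr_eq0.
  rewrite /euler; move: (t / _) k0 kE => k k0 kE.
  suff /(_ n.+1)[Dn qn] : forall j, D (iter j (J k) z) /\
      (1 + j%:R * k * w) * q (iter j (J k) z) <= q z.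
    rewrite kE in qn; rewrite ler_pdivlMr // mulrC; apply: le_trans qn.
    by rewrite ler_pM2l //; exact: qm.
  elim=> [|j [Dj qj]]; first by rewrite /= !mul0r addr0 mul1r.
  have [Dj' qj'] := Dq k _ k0 Dj; split=> //=.
  have jk : 0 <= j%:R * k * w by rewrite !mulr_ge0 // ltW.
  have kw : 0 <= k * w by rewrite mulr_ge0 // ltW.
  have := q0 _ Dj'; set a := q (J k _) in qj' *; set b := q _ in qj qj'.
  move=> a0; apply: le_trans qj; have jk1 : 0 <= 1 + j%:R * k * w by lra.
  apply: le_trans (ler_wpM2l jk1 qj'); rewrite mulrSr -subr_ge0.
  rewrite (_ : _ - _ = j%:R * k * w * (k * w) * a); last by ring.
  exact: mulr_ge0 (mulr_ge0 jk kw) a0.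
have c : m * rnorm (euler A t n z) ^+ 2 @[n --> \oo] --> m * rnorm (T t z) ^+ 2.
  apply: cvgMr; rewrite expr2; apply: cvgM; apply: cvg_rnorm; apply: euler_cvg;
    by [exact: ltW|exact: DS].
by apply: (cvgr_to_le c); exact: nearW.
Qed.

Lemma exp_eigen_decay (m t : R) x : 0 <= m -> dom A x -> A x = - (m%:C *: x) ->
  0 <= t -> rnorm (T t x) ^+ 2 <= rnorm x ^+ 2 / (1 + t * m).
Proof.
move=> m0 Dx Ax t0; pose D := [set y | exists r : R, y = r%:C *: x].
have DS : D `<=` S by move=> _ [r ->]; apply: subspaceZ => //; exact: domS.
have Dx1 : D x by exists 1; rewrite rmorph1 scale1r.
have := @exp_decay D (fun y => rnorm y ^+ 2) 1 m ltr01 m0 DS _ _ t x t0 Dx1.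
rewrite mul1r; apply; last by move=> z _; rewrite mul1r.
move=> h _ h0 [r ->].
have k0 : 0 < 1 + h * m by have := mulr_ge0 (ltW h0) m0; lra.
have -> : J h (r%:C *: x) = (r / (1 + h * m))%:C *: x.
  have -> : r%:C *: x = (r / (1 + h * m))%:C *: x -
      h%:C *: A ((r / (1 + h * m))%:C *: x).
    rewrite AZ // Ax !scalerN opprK !scalerA -!rmorphM -scalerDl -rmorphD.
    by congr (_%:C *: _); field; exact: lt0r_neq0.
  by apply: resolventK => //; exact: subspaceZ.
split; first by exists (r / (1 + h * m)).
rewrite !rnormZ !exprMn !real_normK ?num_real // expr_div_n mulrA.
apply: ler_wpM2r; first exact: sqr_ge0.
have -> : (1 + h * m) * (r ^+ 2 / (1 + h * m) ^+ 2) = r ^+ 2 / (1 + h * m).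
  by field; exact: lt0r_neq0.
rewrite ler_pdivrMr // ler_peMr ?sqr_ge0 //.
by have := mulr_ge0 (ltW h0) m0; lra.
Qed.

End LumerPhillips.

(** * The damped operator is m-dissipative *)

Local Arguments opfun : simpl never.

Section Preliminaries.
Variable R : realType.

Lemma dense_rnorm (V : normedModType R[i]) (S : set V) x (e : R) :
  dense S -> 0 < e -> exists y, S y /\ rnorm (x - y) < e.
Proof.
move=> dS e0; have [||y [xy Sy]] := dS (ball x e%:C).
- by exists x; apply: ballxx; rewrite ltcR.
- exact: ball_open.
exists y; split=> //; move: xy; rewrite -ball_normE /ball_ /= rnormE ltcR.
by [].
Qed.

Lemma dense_orth0 (H : hilbertType R) (S : set H) z :
  dense S -> (forall x, S x -> rinner x z = 0) -> z = 0.
Proof.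
move=> dS Sz; apply: rnorm_eq0; apply: le_anti; rewrite rnorm_ge0 andbT.
apply/ler_addgt0Pl => e e0; rewrite addr0.
have [y [Sy zy]] := dense_rnorm z dS e0.
have := rcauchy_schwarz (z - y) z; rewrite rinnerBl (Sz _ Sy) subr0 rinnerxx.
rewrite ger0_norm ?sqr_ge0 // expr2.
have [->|z0] := eqVneq (rnorm z) 0; first by move=> _; exact: ltW.
by rewrite ler_pM2r ?lt_def ?z0 ?rnorm_ge0 // => h; apply: le_trans h (ltW zy).
Qed.

Lemma closed_op_seq (U V : normedModType R[i]) (A : operator U V) (u : nat -> U) x y :
  closed_op A -> (forall n, dom A (u n)) -> u @ \oo --> x ->
  A (u n) @[n --> \oo] --> y -> dom A x /\ A x = y.
Proof.
move=> Ac Du ux Auy.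
have c : (fun n => (u n, A (u n))) @ \oo --> (x, y) by exact: cvg_pair.
have gr : \forall n \near \oo, dom A (u n, A (u n)).1 /\ (u n, A (u n)).2 = A (u n, A (u n)).1.
  by apply: nearW => n; split; [exact: Du|].
by have [Dx /= ->] := closed_cvg _ Ac gr _ c.
Qed.

Lemma graph_norm_le (U V : normedModType R[i]) (A : operator U V) x :
  graph_norm A x <= (rnorm x + rnorm (A x))%:C.
Proof.
rewrite rmorphD /= -!rnormE /graph_norm.
rewrite -(@ler_pXn2r _ 2) ?nnegrE ?addr_ge0 ?sqrtC_ge0 ?exprn_ge0 //.
by rewrite sqrtCK sqrrD addrAC lerDl mulrn_wge0 ?mulr_ge0.
Qed.

Section Adjoint.
Variables (H K : hilbertType R) (C : operator H K).
Hypothesis C_dense : densely_defined C.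

Lemma adjointE y : dom (adjoint C) y ->
  forall x, dom C x -> inner (C x) y = inner x (adjoint C y).
Proof. by move=> Dy; have /= := @xgetPex _ 0 _ Dy; apply. Qed.

Lemma adjointP y z : (forall x, dom C x -> inner (C x) y = inner x z) ->
  dom (adjoint C) y /\ adjoint C y = z.
Proof.
move=> yz; have Dy : dom (adjoint C) y by exists z.
split=> //; apply/eqP; rewrite -subr_eq0; apply/eqP; apply: (dense_orth0 C_dense) => x Dx.
by rewrite rinnerBr /rinner -(adjointE Dy) // yz // subrr.
Qed.

Lemma adjoint_linear : linear_op (adjoint C).
Proof.
have lin a y z : dom (adjoint C) y -> dom (adjoint C) z ->
    dom (adjoint C) (a *: y + z) /\
    adjoint C (a *: y + z) = a *: adjoint C y + adjoint C z.
  move=> Dy Dz; apply: adjointP => x Dx.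
  by rewrite !linearDr !linearZr_LR /= !adjointE.
split; first split.
- by exists 0 => x Dx; rewrite !linear0r.
- by move=> a y z Dy Dz; have [] := lin a y z Dy Dz.
- by move=> a y z Dy Dz; have [] := lin a y z Dy Dz.
Qed.

End Adjoint.

Section Product.
Variables U V : hilbertType R.
Implicit Types z w : hprod U V.

Lemma hprod_eq z w : z.1 = w.1 -> z.2 = w.2 -> z = w.
Proof. by case: z w => [? ?] [? ?] /= -> ->. Qed.

Lemma hprod_rinner z w : rinner z w = rinner z.1 w.1 + rinner z.2 w.2.
Proof.
rewrite /rinner; change (inner z w) with (inner z.1 w.1 + inner z.2 w.2).
by case: (inner z.1 _) (inner z.2 _) => ? ? [? ?].
Qed.

Lemma hprod_rnorm z : rnorm z ^+ 2 = rnorm z.1 ^+ 2 + rnorm z.2 ^+ 2.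
Proof. by rewrite -!rinnerxx hprod_rinner. Qed.

Lemma hprod_rnorm1 z : rnorm z.1 <= rnorm z.
Proof. by rewrite -lecR -!rnormE hprod_norm1. Qed.

Lemma hprod_rnorm2 z : rnorm z.2 <= rnorm z.
Proof. by rewrite -lecR -!rnormE hprod_norm2. Qed.

Lemma hpair_rnormr0 (x : U) : rnorm (hpair x (0 : V)) = rnorm x.
Proof.
apply/eqP; rewrite -(@eqrXn2 _ 2) ?rnorm_ge0 // hprod_rnorm /= rnorm0.
by rewrite expr0n addr0.
Qed.

Lemma cvg_hprod1 (u : nat -> hprod U V) z : u @ \oo --> z -> (u n).1 @[n --> \oo] --> z.1.
Proof.
move=> /cvg_rnormP uz; apply/cvg_rnormP => e /uz; apply: filterS => n.
by apply: le_lt_trans; exact: (hprod_rnorm1 (z - u n)).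
Qed.

Lemma cvg_hprod2 (u : nat -> hprod U V) z : u @ \oo --> z -> (u n).2 @[n --> \oo] --> z.2.
Proof.
move=> /cvg_rnormP uz; apply/cvg_rnormP => e /uz; apply: filterS => n.
by apply: le_lt_trans; exact: (hprod_rnorm2 (z - u n)).
Qed.

End Product.

End Preliminaries.

Section DampedOperator.
Variables (R : realType) (H0 H1 : hilbertType R) (C : operator H0 H1).
Hypotheses (C_linear : linear_op C) (C_dense : densely_defined C) (C_closed : closed_op C).
Hypothesis C_ran : seq_closed (ran C).
Variable gamma : {linear H0 -> H0}.
Hypotheses (gamma_bounded : exists2 K, 0 <= K & forall x, rnorm (gamma x) <= K * rnorm x)
  (gamma_sym : forall x y, rinner (gamma x) y = rinner x (gamma y))
  (gamma_ge0 : forall x, 0 <= rinner (gamma x) x).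

Let Ds : subspace_set (dom C). Proof. by case: C_linear. Qed.
Let Clin : linear_on (dom C) C. Proof. by case: C_linear. Qed.

Lemma lin_op0 : C 0 = 0.
Proof.
have h := Clin (-1) (subspace0 Ds) (subspace0 Ds).
by rewrite !scaleN1r oppr0 addr0 addNr in h.
Qed.

Lemma lin_opZ a x : dom C x -> C (a *: x) = a *: C x.
Proof. by move=> Dx; have := Clin a Dx (subspace0 Ds); rewrite lin_op0 !addr0. Qed.

Lemma lin_opD x y : dom C x -> dom C y -> C (x + y) = C x + C y.
Proof. by move=> Dx Dy; have := Clin 1 Dx Dy; rewrite !scale1r. Qed.

Lemma lin_opB x y : dom C x -> dom C y -> C (x - y) = C x - C y.
Proof.
by move=> Dx Dy; have := Clin (-1) Dy Dx; rewrite !scaleN1r ![- _ + _]addrC.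
Qed.

Lemma ran_subspace : subspace_set (ran C).
Proof.
split; first by exists 0; [exact: subspace0|exact: lin_op0].
move=> a _ _ [x Dx <-] [y Dy <-]; exists (a *: x + y); last exact: Clin.
by apply: subspaceD => //; exact: subspaceZ.
Qed.

Let A := damped_op C gamma.

Lemma damped1 z : (A z).1 = adjoint C z.2 - gamma z.1.
Proof. by rewrite /A /damped_op /opfun /= opprK addrC. Qed.

Lemma damped2 z : (A z).2 = - C z.1.
Proof. by rewrite /A /damped_op /opfun /= oppr0 add0r. Qed.

Lemma damped_diss z : dom A z -> rinner (A z) z = - rinner (gamma z.1) z.1.
Proof.
case=> Dx [Dy _]; rewrite hprod_rinner damped1 damped2 rinnerBl rinnerNl.
have -> : rinner (C z.1) z.2 = rinner z.1 (adjoint C z.2) by rewrite /rinner adjointE.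
by rewrite (rinnerC (adjoint _ _)) addrAC subrr add0r.
Qed.

(** The first equation of [u - h A u = z] is, in weak form and after eliminating
    the second component [y = g - h C x], the variational equation of the form
    [<x, x'> + h^2 <C x, C x'> + h <gamma x, x'>]; it is posed on the graph of
    [h C], which is closed in the product space. The weak form also says that
    [y] lies in the domain of the adjoint. *)
Lemma damped_onto (h : R) z : 0 < h -> ran C z.2 ->
  exists u, dom A u /\ u - h%:C *: A u = z.
Proof.
move=> h0; case: z => f g /= Cg.
have hC : h%:C != 0 :> R[i] by rewrite (inj_eq (@complexI R)) gt_eqF.
pose G := [set z : hprod H0 H1 | dom C z.1 /\ z.2 = h%:C *: C z.1].
pose a (z w : hprod H0 H1) := rinner z w + h * rinner (gamma z.1) w.1.
have Gs : subspace_set G.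
  split; first by split; [exact: subspace0|rewrite lin_op0 scaler0].
  move=> c z w [Dz ez] [Dw ew]; split=> /=.
    by apply: subspaceD => //; exact: subspaceZ.
  by rewrite ez ew Clin // scalerDr !scalerA mulrC.
have Gc : seq_closed G.
  move=> u z uG uz; have u1 := cvg_hprod1 uz; have u2 := cvg_hprod2 uz.
  have c : C (u n).1 @[n --> \oo] --> (h%:C)^-1 *: z.2.
    rewrite (_ : (fun n => _) = (fun n => (h%:C)^-1 *: (u n).2)); first exact: cvgZr.
    by apply/funext => n; rewrite (uG n).2 scalerA mulVf // scale1r.
  have [Dz ez] := closed_op_seq C_closed (fun n => (uG n).1) u1 c.
  by split; rewrite // ez scalerA divff // scale1r.
have [K K0 gK] := gamma_bounded.
have [||||| [x y'] [[/= Dx ->] xP]] := riesz_form (a := a) (hpair f g) Gs Gc.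
- by move=> z w v; rewrite /a rinnerDl linearD rinnerDl; ring.
- by move=> r z v; rewrite /a rinnerZl linearZ rinnerZl; ring.
- by move=> z w; rewrite /a rinnerC gamma_sym (rinnerC z.1).
- by move=> z; rewrite /a rinnerxx lerDl mulr_ge0 // ltW.
- move=> z; exists (rnorm z + h * K * rnorm z) => w; rewrite /a mulrDl.
  apply: lerD; first by rewrite mulrC (le_trans (ler_norm _)) // rcauchy_schwarz.
  rewrite -!mulrA (ler_pM2l h0) (le_trans (ler_norm _)) //.
  apply: le_trans (rcauchy_schwarz _ _) _; rewrite [rnorm z * _]mulrC mulrA.
  apply: ler_pM; rewrite ?rnorm_ge0 //; last exact: hprod_rnorm1.
  apply: le_trans (gK _) _; apply: ler_wpM2l => //; exact: hprod_rnorm1.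
have xE v : dom C v ->
    inner (C v) (g - h%:C *: C x) = inner v ((h%:C)^-1 *: (x + h%:C *: gamma x - f)).
  move=> Dv; apply: inner_eqP => c; rewrite -lin_opZ //.
  have Dcv : dom C (c *: v) by exact: subspaceZ.
  have := xP (hpair (c *: v) (h%:C *: C (c *: v))) (conj Dcv erefl).
  rewrite /a !hprod_rinner /= !rinnerE => e.
  rewrite -fmorphV !rinnerE; apply: (mulfI (x := h)); first by rewrite gt_eqF.
  rewrite mulrA divff ?gt_eqF // mul1r.
  rewrite (rinnerC _ g) (rinnerC _ f) (rinnerC _ (C x)) (rinnerC _ x) (rinnerC _ (gamma x)).
  lra.
have [Dy ey] := adjointP C_dense xE.
exists (hpair x (g - h%:C *: C x)); split.
  split=> //=; split=> //; apply: subspaceB => //; first exact: ran_subspace.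
  by apply: subspaceZ; [exact: ran_subspace|exists x].
apply: hprod_eq; last first.
  transitivity ((g - h%:C *: C x) - h%:C *: (A (hpair x (g - h%:C *: C x))).2) => //.
  by rewrite damped2 /= scalerN opprK subrK.
transitivity (x - h%:C *: (A (hpair x (g - h%:C *: C x))).1) => //.
rewrite damped1 /= ey scalerBr scalerA divff // scale1r.
by rewrite addrAC addrK subKr.
Qed.

Lemma damped_m_dissipative : m_dissipative_on (state_space C) A.
Proof.
have [Cs0 Cs] := ran_subspace.
have [[Ad0 Ads] Adl] := adjoint_linear C_dense.
split.
- split; first exact: Cs0.
  by move=> a z w /= Cz Cw; exact: Cs.
- by move=> u z Su uz; exact: C_ran Su (cvg_hprod2 uz).
- split; first split.
  + by split; [exact: subspace0|split].
  + move=> a z w [Dz [Dz' Cz]] [Dw [Dw' Cw]]; split=> /=.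
      by apply: subspaceD => //; exact: subspaceZ.
    by split; [exact: Ads|exact: Cs].
  move=> a z w [Dz [Dz' Cz]] [Dw [Dw' Cw]].
  apply: hprod_eq.
    rewrite damped1 /= Adl // linearP.
    transitivity (a *: (A z).1 + (A w).1) => //.
    by rewrite !damped1 scalerBr opprD addrACA.
  transitivity (a *: (A z).2 + (A w).2) => //.
  by rewrite !damped2 /= Clin // opprD scalerN.
- by move=> z [_ []].
- move=> z [Dz _]; suff : ran C (A z).2 by []; rewrite damped2.
  by apply: subspaceN; [exact: ran_subspace|exists z.1].
- by move=> z Dz; rewrite damped_diss // oppr_le0.
- by move=> h z h0 Sz; exact: damped_onto.
Qed.

End DampedOperator.

(** * Closed range from compactness *)

Section ClosedRange.
Variables (R : realType) (H0 H1 : hilbertType R) (C : operator H0 H1).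
Hypotheses (C_linear : linear_op C) (C_closed : closed_op C).
Hypothesis C_compact : compact_graph_embedding C
  (dom C `&` orthogonal_compl (ker C)).

Let Ds : subspace_set (dom C). Proof. by case: C_linear. Qed.
Let E := dom C `&` orthogonal_compl (ker C).

Lemma ker_subspace : subspace_set (ker C).
Proof.
split; first by split; [exact: subspace0|exact: lin_op0].
move=> a x y [Dx x0] [Dy y0]; split; first by apply: subspaceD => //; exact: subspaceZ.
by have [_ ->] := C_linear; rewrite // x0 y0 scaler0 addr0.
Qed.

Lemma ker_closed : seq_closed (ker C).
Proof.
move=> u l uk ul; apply: (closed_op_seq C_closed (fun n => (uk n).1) ul).
rewrite (_ : (fun n => _) = fun=> 0); first exact: cvg_cst.
by apply/funext => n; have [] := uk n.
Qed.

Lemma orthogonal_complP (H : hilbertType R) (S : set H) x : subspace_set S ->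
  (forall v, S v -> rinner x v = 0) -> orthogonal_compl S x.
Proof.
move=> Ss xS v Sv.
by apply: inner_eq0 => a; apply: xS; exact: subspaceZ.
Qed.

Let E_subspace : subspace_set E.
Proof.
split; first by split; [exact: subspace0|move=> y _; rewrite linear0l].
move=> a x y [Dx ox] [Dy oy]; split; first by apply: subspaceD => //; exact: subspaceZ.
by move=> z kz; rewrite linearDl linearZl_LR /= ox // oy // mulr0 addr0.
Qed.

(** Subtract the projection onto [ker C]. *)
Lemma ker_compl_part x : dom C x -> exists x',
  [/\ E x', C x' = C x & rinner x x' <= rnorm x ^+ 2].
Proof.
move=> Dx; have [p [kp pP]] := orth_proj x ker_subspace ker_closed.
have [Dp p0] := kp; exists (x - p); split.
- split; first exact: subspaceB.
  by apply: orthogonal_complP => //; exact: ker_subspace.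
- by rewrite lin_opB // p0 subr0.
rewrite rinnerBr rinnerxx lerBlDr lerDl.
have := pP _ kp; rewrite rinnerBl => /eqP; rewrite subr_eq0 => /eqP ->.
exact: rinner_ge0.
Qed.

(** A sequence in the orthogonal complement of [ker C] with norms [1/2] along which
    [C] tends to [0] would, by compactness, have a subsequence converging to a
    vector of norm [1/2] lying both in [ker C] and in its complement. *)
Lemma bounded_below : exists2 M : R, 0 < M &
  forall x, E x -> rnorm x <= M * rnorm (C x).
Proof.
apply: contrapT => noM.
have /choice[u uP] : forall n : nat, exists x,
    [/\ E x, rnorm x = 2^-1 & rnorm (C x) <= 2^-1 * harmonic n].
  move=> n; have /existsNP[x /not_implyP[Ex /negP]] :
      ~ forall x, E x -> rnorm x <= n.+1%:R * rnorm (C x).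
    by move=> h; apply: noM; exists n.+1%:R.
  rewrite -ltNge => Cx.
  have x0 : 0 < rnorm x by apply: le_lt_trans Cx; rewrite mulr_ge0 ?rnorm_ge0.
  have k0 : 0 < (2 * rnorm x)^-1 by rewrite invr_gt0 mulr_gt0.
  exists (((2 * rnorm x)^-1)%:C *: x); split; first exact: subspaceZ.
    by rewrite rnormZ (ger0_norm (ltW k0)); field; exact: lt0r_neq0.
  have Dx : dom C x by case: Ex.
  rewrite lin_opZ // rnormZ (ger0_norm (ltW k0)) invfM -mulrA ler_pM2l ?invr_gt0 //.
  rewrite /harmonic /= -(ler_pM2l x0) mulrA divff ?lt0r_neq0 // mul1r.
  by rewrite ler_pdivlMr ?ltr0Sn // mulrC ltW.
pose B := [set x | E x /\ graph_norm C x <= 1].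
have uB n : B (u n).
  have [Eu u1 Cu] := uP n; split=> //; apply: le_trans (graph_norm_le _ _) _.
  rewrite (_ : 1 = 1%:C) // lecR u1.
  have : harmonic n <= 1 :> R by rewrite /harmonic /= invf_le1 // ler1n.
  lra.
have [x [_ xcl]] : closure B `&` cluster (u @ \oo) !=set0.
  move: C_compact; rewrite /compact_graph_embedding precompactE; apply.
  by exists 0 => // n _; apply: subset_closure; exact: uB.
have /choice[f fP] : forall k : nat, exists n, (k <= n)%N /\ rnorm (x - u n) < harmonic k.
  move=> k; have hk : 0 < harmonic k :> R by rewrite /harmonic /= invr_gt0 ltr0Sn.
  have [||y [[n kn <-] xy]] := xcl (u @` [set n | (k <= n)%N]) (ball x (harmonic k)%:C).
  - by exists k => // n kn; exists n.
  - by apply: nbhsx_ballx; rewrite ltcR.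
  by exists n; split=> //; move: xy; rewrite -ball_normE /ball_ /= rnormE ltcR.
have fx : u (f n) @[n --> \oo] --> x.
  apply: (cvg_rnorm_le _ (@cvg_harmonic R)) => n; apply: ltW; exact: (fP n).2.
have Cf : C (u (f n)) @[n --> \oo] --> 0.
  apply: (cvg_rnorm_le _ (@cvg_harmonic R)) => n; rewrite sub0r rnormN.
  have [_ _ h] := uP (f n); have [fn _] := fP n; apply: le_trans h _.
  have : harmonic (f n) <= harmonic n :> R.
    by rewrite /harmonic /= lef_pV2 ?posrE ?ltr0Sn // ler_nat ltnS.
  have : 0 <= harmonic (f n) :> R by rewrite /harmonic /= invr_ge0.
  lra.
have Df n : dom C (u (f n)) by have [[]] := uP (f n).
have [Dx Cx] := closed_op_seq C_closed Df fx Cf.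
have c1 : rinner (u (f n)) x @[n --> \oo] --> rinner x x by exact: cvg_rinner.
have c2 : rnorm (u (f n)) @[n --> \oo] --> rnorm x by exact: cvg_rnorm.
have e1 : rinner x x = 0.
  apply: (cvg_unique _ c1); first exact: norm_hausdorff.
  rewrite (_ : (fun n => _) = fun=> 0); first exact: cvg_cst.
  apply/funext => n; have [[_ h] _ _] := uP (f n).
  by rewrite /rinner h.
have e2 : rnorm x = 2^-1.
  apply: (cvg_unique _ c2); first exact: norm_hausdorff.
  rewrite (_ : (fun n => _) = fun=> 2^-1); first exact: cvg_cst.
  by apply/funext => n; have [] := uP (f n).
by move: e1; rewrite rinnerxx e2 => /eqP; rewrite sqrf_eq0 invr_eq0 pnatr_eq0.
Qed.

Lemma closed_range : seq_closed (ran C).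
Proof.
move=> v y rv vy; have [M M0 MP] := bounded_below.
have /choice[u uP] : forall n, exists x, E x /\ C x = v n.
  by move=> n; have [x Dx <-] := rv n; have [x' [Ex' <- _]] := ker_compl_part Dx; exists x'.
have [e e0|x ux] := cvg_rnorm_cauchy (u := u).
  have d0 : 0 < e / M / 2 by rewrite !divr_gt0.
  have /cvg_rnormP/(_ _ d0)[N _ vN] := vy; exists N => n Nn.
  have [[EN eN] [En en]] := (uP N, uP n).
  apply: le_lt_trans (MP _ (subspaceB E_subspace EN En)) _.
  rewrite lin_opB ?eN ?en //; [|by case: EN|by case: En].
  rewrite mulrC -ltr_pdivlMr //.
  apply: le_lt_trans (ler_rdistD y _ _) _; rewrite rdistC.
  have := vN N (leqnn N); have := vN n Nn; rewrite /=; lra.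
have Du n : dom C (u n) by have [[]] := uP n.
have [|Dx <-] := closed_op_seq (y := y) C_closed Du ux; last by exists x.
by rewrite (_ : (fun n => _) = v) //; apply/funext => n; have [] := uP n.
Qed.

(** The right inverse of [C] with values in the orthogonal complement of [ker C].
    For the last clause, [Q (C x)] is the component of [x] in that complement. *)
Lemma range_inverse : exists (S : H1 -> H0) (M : R),
  [/\ forall (r : R) x y, ran C x -> ran C y -> S (x + r%:C *: y) = S x + r%:C *: S y,
      forall y, ran C y -> dom C (S y) /\ C (S y) = y,
      forall y, ran C y -> rnorm (S y) <= M * rnorm y &
      forall x, dom C x -> rinner x (S (C x)) <= rnorm x ^+ 2].
Proof.
have [M M0 MP] := bounded_below.
pose S y := xget 0 [set x | E x /\ C x = y].
have SP y : ran C y -> E (S y) /\ C (S y) = y.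
  move=> [x Dx xy]; have [x' [Ex' ex' _]] := ker_compl_part Dx.
  by apply: (@xgetPex _ 0 [set x | E x /\ C x = y]); exists x'; rewrite /= -xy.
have uniq x x' : E x -> E x' -> C x = C x' -> x = x'.
  move=> Ex Ex' xx'; apply/eqP; rewrite -subr_eq0; apply/eqP/rnorm_eq0/le_anti.
  rewrite rnorm_ge0 andbT; apply: le_trans (MP _ (subspaceB E_subspace Ex Ex')) _.
  by rewrite lin_opB ?xx' ?subrr ?rnorm0 ?mulr0 //; [case: Ex|case: Ex'].
exists S, M; split.
- move=> r x y rx ry; have [Ex ex] := SP _ rx; have [Ey ey] := SP _ ry.
  have ryr : ran C (x + r%:C *: y).
    by apply: subspaceD; [exact: ran_subspace|by []|apply: subspaceZ => //; exact: ran_subspace].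
  have [Exy exy] := SP _ ryr; apply: uniq => //.
    by apply: subspaceD => //; exact: subspaceZ.
  have [[Dx _] [Dy _]] := (Ex, Ey).
  by rewrite lin_opD ?lin_opZ ?exy ?ex ?ey //; exact: subspaceZ.
- by move=> y /SP[[]].
- by move=> y /SP[Ey ey]; rewrite -{2}ey; exact: MP.
- move=> x Dx; have [x' [Ex' ex' xx']] := ker_compl_part Dx.
  have rx : ran C (C x) by exists x.
  have [ES eS] := SP _ rx; rewrite (_ : S (C x) = x') //.
  by apply: uniq => //; rewrite eS.
Qed.

End ClosedRange.

(** * A degenerate damping operator *)

Section Sequences.
Variables (R : realType) (H : hilbertType R).

(** A basis of the intersection and one vector [w] of [L] off the hyperplane would
    generate [L]. *)
Lemma infinite_dim_hyperplane (L : set H) v : subspace_set L -> ~ finite_dim L ->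
  ~ finite_dim (L `&` [set x | inner x v = 0]).
Proof.
move=> Ls Linf [n [e [eL eP]]]; apply: Linf.
have [h|] := pselect (forall x, L x -> inner x v = 0).
  exists n, e; split; first by move=> i; case: (eL i).
  by move=> x Lx; apply: eP; split=> //; exact: h.
move=> /existsNP[w /not_implyP[Lw /eqP wv]].
exists n.+1, (fun i => if unlift ord0 i is Some j then e j else w); split.
  by move=> i; case: unliftP => [j _|_] //; case: (eL j).
move=> x Lx; pose k := inner x v / inner w v.
have [c cE] : exists c : 'I_n -> R[i], x - k *: w = \sum_i c i *: e i.
  apply: eP; split; first by apply: subspaceB => //; exact: subspaceZ.
  by rewrite /= linearBl linearZl_LR /= /k divfK // subrr.
exists (fun i => if unlift ord0 i is Some j then c j else k).
rewrite big_ord_recl unlift_none.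
under eq_bigr do rewrite !liftK.
by rewrite -cE addrC subrK.
Qed.

Lemma infinite_dim_unit (L : set H) : subspace_set L -> ~ finite_dim L ->
  exists u, L u /\ rnorm u = 1.
Proof.
move=> Ls Linf; have [h|] := pselect (forall x, L x -> x = 0).
  exfalso; apply: Linf; exists 0%N, (fun=> 0); split; first by move=> [].
  by move=> x Lx; exists (fun=> 0); rewrite big_ord0; exact: h.
move=> /existsNP[w /not_implyP[Lw w0]].
have k : rnorm w != 0 by apply/eqP => /rnorm_eq0.
exists (((rnorm w)^-1)%:C *: w); split; first exact: subspaceZ.
by rewrite rnormZ ger0_norm ?invr_ge0 ?rnorm_ge0 // mulVf.
Qed.

(** By [infinite_dim_hyperplane] the vectors of [L] orthogonal to any finite list
    still form an infinite-dimensional space, so a unit vector can be picked at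
    each stage. *)
Lemma orthonormal_seq (L : set H) : subspace_set L -> ~ finite_dim L ->
  exists e : nat -> H, [/\ forall n, L (e n), forall n, rnorm (e n) = 1 &
    forall j k, j != k -> inner (e j) (e k) = 0].
Proof.
move=> Ls Linf.
have next (s : seq H) : exists u, [/\ L u, rnorm u = 1 & forall v, v \in s -> inner u v = 0].
  pose Ps (s : seq H) := L `&` [set x | forall v, v \in s -> inner x v = 0].
  have [Pss Psinf] : subspace_set (Ps s) /\ ~ finite_dim (Ps s).
    elim: s => [|v s [IHs IHinf]].
      by rewrite (_ : Ps [::] = L) //; apply/seteqP; split=> x; [case|move=> Lx; split].
    have -> : Ps (v :: s) = Ps s `&` [set x | inner x v = 0].
      apply/seteqP; split=> x.
        move=> [Lx xP]; split; last by apply: xP; rewrite mem_head.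
        by split=> // w ws; apply: xP; rewrite inE ws orbT.
      by move=> [[Lx xP] xv]; split=> // w; rewrite inE => /predU1P[->|/xP].
    split; last exact: infinite_dim_hyperplane.
    split; first by split; [exact: subspace0|rewrite /= linear0l].
    move=> a x y [Px xv] [Py yv]; split; first by apply: subspaceD => //; exact: subspaceZ.
    by rewrite /= linearDl linearZl_LR /= xv yv mulr0 addr0.
  by have [u [[Lu uP] u1]] := infinite_dim_unit Pss Psinf; exists u.
have /choice[f fP] := next.
pose gen n := iter n (fun s => f s :: s) [::]; pose e n := f (gen n).
have mem_gen j k : (j < k)%N -> e j \in gen k.
  elim: k => // k IH; rewrite ltnS leq_eqVlt => /predU1P[->|/IH h].
    by rewrite /gen iterS mem_head.
  by rewrite /gen iterS inE h orbT.
have orth j k : (j < k)%N -> inner (e k) (e j) = 0.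
  by move=> /mem_gen; have [_ _] := fP (gen k); apply.
exists e; split; try by move=> n; case: (fP (gen n)).
move=> j k; rewrite neq_ltn => /orP[|/orth//].
by move=> /orth/inner_sym0.
Qed.

End Sequences.

Section PositiveOperators.
Variables (R : realType) (H : hilbertType R).

Record positive_bounded (f : H -> H) : Prop := {
  pos_linear : linear f;
  pos_bounded : exists2 K, 0 <= K & forall x, rnorm (f x) <= K * rnorm x;
  pos_sym : forall x y, rinner (f x) y = rinner x (f y);
  pos_ge0 : forall x, 0 <= rinner (f x) x }.

Lemma positive_boundedD f g : positive_bounded f -> positive_bounded g ->
  positive_bounded (fun x => f x + g x).
Proof.
move=> [fl [K K0 fK] fs f0] [gl [L L0 gL] gs g0]; split.
- by move=> a x y; rewrite fl gl scalerDr addrACA.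
- exists (K + L); first exact: addr_ge0.
  by move=> x; rewrite mulrDl (le_trans (ler_rnormD _ _)) // lerD.
- by move=> x y; rewrite rinnerDl rinnerDr fs gs.
- by move=> x; rewrite rinnerDl addr_ge0.
Qed.

Lemma positive_boundedZ (r : R) f : 0 <= r -> positive_bounded f ->
  positive_bounded (fun x => r%:C *: f x).
Proof.
move=> r0 [fl [K K0 fK] fs f0]; split.
- by move=> a x y; rewrite fl scalerDr !scalerA mulrC.
- exists (r * K); first exact: mulr_ge0.
  by move=> x; rewrite rnormZ ger0_norm // -mulrA ler_wpM2l.
- by move=> x y; rewrite rinnerZl rinnerZr fs.
- by move=> x; rewrite rinnerZl mulr_ge0.
Qed.

Lemma positive_bounded_lim (f : nat -> H -> H) (g : H -> H) (K : R) : 0 <= K ->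
  (forall n, positive_bounded (f n)) -> (forall n x, rnorm (f n x) <= K * rnorm x) ->
  (forall x, f n x @[n --> \oo] --> g x) -> positive_bounded g.
Proof.
move=> K0 fp fK fg; split.
- move=> a x y; apply: (cvg_unique _ (fg _)); first exact: norm_hausdorff.
  rewrite (_ : (fun n => _) = (fun n => a *: f n x + f n y)); last first.
    by apply/funext => n; rewrite (pos_linear (fp n)).
  by apply: cvgD; [apply: cvgZr|]; exact: fg.
- exists K => // x; apply: (cvgr_to_le (cvg_rnorm (fg x))); exact: nearW.
- move=> x y; have c : rinner (f n x) y @[n --> \oo] --> rinner (g x) y by exact: cvg_rinner.
  apply: (cvg_unique _ c); first exact: norm_hausdorff.
  rewrite rinnerC (_ : (fun n => _) = (fun n => rinner (f n y) x)); first exact: cvg_rinner.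
  by apply/funext => n; rewrite (pos_sym (fp n)) rinnerC.
- move=> x; have c : rinner (f n x) x @[n --> \oo] --> rinner (g x) x by exact: cvg_rinner.
  by apply: (cvgr_to_ge c); apply: nearW => n; exact: pos_ge0.
Qed.

Lemma positive_bounded0 : positive_bounded (fun=> 0).
Proof.
split=> [a x y||x y|x]; rewrite ?rinner0l ?rinner0r //.
  by rewrite scaler0 addr0.
by exists 0 => // x; rewrite rnorm0 mul0r.
Qed.

(** The hypothesis says [<x, f y> = <f x, f y>], which is symmetric in [x] and [y]. *)
Lemma proj_positive (f : H -> H) : linear f ->
  (forall x y, rinner (x - f x) (f y) = 0) -> positive_bounded f /\
  forall x, rnorm (f x) <= rnorm x.
Proof.
move=> fl fP.
have e x y : rinner x (f y) = rinner (f x) (f y).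
  by have /eqP := fP x y; rewrite rinnerBl subr_eq0 => /eqP.
have f1 x : rnorm (f x) <= rnorm x.
  have [->|x0] := eqVneq (rnorm (f x)) 0; first exact: rnorm_ge0.
  rewrite -(@ler_pM2r _ (rnorm (f x))); last by rewrite lt_def x0 rnorm_ge0.
  by rewrite -expr2 -rinnerxx -e (le_trans (ler_norm _)) // rcauchy_schwarz.
split=> //; split=> //.
- by exists 1 => // x; rewrite mul1r.
- by move=> x y; rewrite e rinnerC e rinnerC.
- by move=> x; rewrite rinnerC e rinner_ge0.
Qed.

Lemma orth_projection (M : set H) : subspace_set M -> seq_closed M ->
  exists P : H -> H, [/\ positive_bounded P, forall x, M x -> P x = x &
    forall x, (forall v, M v -> rinner x v = 0) -> P x = 0].
Proof.
move=> Ms Mc; have /choice[P PP] := fun x => orth_proj x Ms Mc.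
have uniq x p : M p -> (forall v, M v -> rinner (x - p) v = 0) -> P x = p.
  move=> Mp pP; have [MP Px] := PP x; apply/eqP; rewrite -subr_eq0; apply/eqP.
  apply: rinner_eq0; have Md := subspaceB Ms MP Mp.
  have := pP _ Md; rewrite -{1}(subrK (P x) x) -addrA rinnerDl Px // add0r.
  by [].
have MP x : M (P x) by case: (PP x).
have Pl : linear P.
  move=> a x y; apply: uniq; first by apply: subspaceD => //; exact: subspaceZ.
  move=> v Mv; rewrite opprD addrACA -scalerBr rinnerDl (PP y).2 // addr0.
  have := orthogonal_complP Ms (PP x).2 Mv; rewrite /rinner linearZl_LR /= => ->.
  by rewrite mulr0.
exists P; split.
- by have [] := proj_positive Pl (fun x y => (PP x).2 _ (MP y)).
- by move=> x Mx; apply: uniq => // v _; rewrite subrr rinner0l.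
- by move=> x xM; apply: uniq; [exact: subspace0|rewrite subr0].
Qed.

Definition rank_one (e x : H) := inner x e *: e.

Lemma rank_one_positive e : rnorm e = 1 -> positive_bounded (rank_one e) /\
  forall x, rnorm (rank_one e x) <= rnorm x.
Proof.
move=> e1; apply: proj_positive.
  by move=> a x y; rewrite /rank_one linearDl linearZl_LR /= scalerDl scalerA.
move=> x y; rewrite /rank_one /rinner linearZr_LR /= linearBl linearZl_LR /=.
by rewrite -normsq_inner rnormE e1 expr1n mulr1 subrr mulr0.
Qed.

(** The series of [2^-k <x, e_k> e_k] converges absolutely. *)
Lemma diagonal_operator (e : nat -> H) : (forall n, rnorm (e n) = 1) ->
  (forall j k, j != k -> inner (e j) (e k) = 0) ->
  exists D : H -> H, [/\ positive_bounded D,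
    forall x, (forall n, inner x (e n) = 0) -> D x = 0 &
    forall n, D (e n) = (2^-1 ^+ n)%:C *: e n].
Proof.
move=> e1 eo; pose f n x := \sum_(k < n) (2^-1 ^+ k)%:C *: rank_one (e k) x.
have h0 k : 0 <= 2^-1 ^+ k :> R by rewrite exprn_ge0.
have fS n x : f n.+1 x = f n x + (2^-1 ^+ n)%:C *: rank_one (e n) x.
  by rewrite /f big_ord_recr.
have fp n : positive_bounded (f n).
  elim: n => [|n IH].
    rewrite (_ : f 0%N = fun=> 0); first exact: positive_bounded0.
    by apply/funext => x; rewrite /f big_ord0.
  rewrite (_ : f n.+1 = fun x => f n x + (2^-1 ^+ n)%:C *: rank_one (e n) x); last first.
    by apply/funext => x; rewrite fS.
  apply: positive_boundedD => //; apply: positive_boundedZ => //.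
  by have [] := rank_one_positive (e1 n).
have fd n m x : rnorm (f n x - f (n + m)%N x) <= 2 * (2^-1 ^+ n - 2^-1 ^+ (n + m)) * rnorm x.
  elim: m => [|m IH]; first by rewrite addn0 !subrr rnorm0 mulr0 mul0r.
  rewrite addnS fS opprD addrA exprS.
  apply: le_trans (ler_rnormD _ _) _; rewrite rnormN rnormZ ger0_norm //.
  have [_ /(_ x) r1] := rank_one_positive (e1 (n + m)%N).
  have := ler_wpM2l (h0 (n + m)%N) r1; move: IH => /=.
  set t := 2^-1 ^+ (n + m); set s := 2^-1 ^+ n; lra.
have fd' n m x : (n <= m)%N -> rnorm (f n x - f m x) <= 2 * 2^-1 ^+ n * rnorm x.
  move=> /subnKC <-; apply: le_trans (fd _ _ _) _.
  by apply: ler_wpM2r; [exact: rnorm_ge0|have := h0 (n + (m - n))%N; lra].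
have /choice[D fD] : forall x, exists y : H, f n x @[n --> \oo] --> y.
  move=> x; apply: (cvg_rnorm_cauchy_rate (b := fun n => 2 * 2^-1 ^+ n * rnorm x));
    last by move=> n m /fd'.
  have -> : (0 : R) = 2 * 0 * rnorm x by rewrite mulr0 mul0r.
  apply: cvgMl; apply: cvgMr; apply: cvg_expr.
  by rewrite ger0_norm ?invr_ge0 // invf_lt1 // ltr1n.
have fK n x : rnorm (f n x) <= 2 * rnorm x.
  have := @fd' 0%N n x (leq0n n).
  by rewrite /f big_ord0 sub0r rnormN expr0 mulr1.
exists D; split; first by apply: (positive_bounded_lim _ fp fK fD).
- move=> x xe; apply: (cvg_unique _ (fD x)); first exact: norm_hausdorff.
  rewrite (_ : (fun n => _) = fun=> 0); first exact: cvg_cst.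
  by apply/funext => n; rewrite /f big1 // => k _; rewrite /rank_one xe scale0r scaler0.
- move=> j; apply: (cvg_unique _ (fD _)); first exact: norm_hausdorff.
  apply: cvg_near_cst; exists j.+1 => // n /= jn.
  rewrite /f (bigD1 (Ordinal jn)) //= big1 ?addr0.
    by rewrite /rank_one -normsq_inner rnormE e1 expr1n scale1r.
  move=> k; rewrite -val_eqE /= => kj.
  by rewrite /rank_one eo ?scale0r ?scaler0 // eq_sym.
Qed.

End PositiveOperators.

Section DampingOperator.
Variables (R : realType) (H : hilbertType R).

Lemma inner0_closed (v : H) : seq_closed [set x | inner x v = 0].
Proof.
move=> u l uv ul; rewrite /= -(linear0l (inner : {dot H for _}) v).
apply: inner_eqP => a; rewrite scaler0 rinner0l.
have c : rinner (a *: u n) v @[n --> \oo] --> rinner (a *: l) v.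
  by apply: cvg_rinner; exact: cvgZr.
apply: (cvg_unique _ c); first exact: norm_hausdorff.
rewrite (_ : (fun n => _) = fun=> 0); first exact: cvg_cst.
by apply/funext => n; rewrite /rinner linearZl_LR /= uv mulr0.
Qed.

(** The projection onto the orthogonal complement of the sequence is added to the
    diagonal operator of weights [2^-n], so that the sum is injective although
    its restriction to [L] is not bounded below. *)
Lemma degenerate_damping (L : set H) : subspace_set L -> ~ finite_dim L ->
  exists (e : nat -> H) (gamma : H -> H), [/\
    forall n, L (e n) /\ rnorm (e n) = 1, positive_bounded gamma,
    forall x, (forall n, inner x (e n) = 0) -> gamma x = x &
    forall n, gamma (e n) = (2^-1 ^+ n)%:C *: e n].
Proof.
move=> Ls Linf; have [e [eL e1 eo]] := orthonormal_seq Ls Linf.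
have [D [Dp D0 De]] := diagonal_operator e1 eo.
pose M := [set x | forall n, inner x (e n) = 0].
have Ms : subspace_set M.
  split; first by move=> n; rewrite linear0l.
  by move=> a x y Mx My n; rewrite linearDl linearZl_LR /= Mx My mulr0 addr0.
have Mc : seq_closed M.
  by move=> u l uM ul n; apply: (inner0_closed _ ul) => k; exact: uM.
have [P [Pp P1 P0]] := orth_projection Ms Mc.
exists e, (fun x => P x + D x); split.
- by move=> n; split.
- exact: positive_boundedD.
- by move=> x xM; rewrite P1 // D0 // addr0.
- move=> n; rewrite De P0 ?add0r // => v Mv.
  by rewrite rinnerC /rinner Mv.
Qed.

End DampingOperator.

(** * Strong stability without semi-uniform stability *)

Section Stability.
Variables (R : realType) (H0 H1 : hilbertType R) (C : operator H0 H1).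
Hypotheses (C_linear : linear_op C) (C_dense : densely_defined C) (C_closed : closed_op C).
Hypothesis C_compact : compact_graph_embedding C
  (dom C `&` orthogonal_compl (ker C)).
Variables (gamma : {linear H0 -> H0}) (e : nat -> H0).
Hypothesis gamma_pos : positive_bounded gamma.
Hypothesis e_ker : forall n, ker C (e n).
Hypothesis e1 : forall n, rnorm (e n) = 1.
Hypothesis gamma_id : forall x, (forall n, inner x (e n) = 0) -> gamma x = x.
Hypothesis gamma_e : forall n, gamma (e n) = (2^-1 ^+ n)%:C *: e n.

Let A := damped_op C gamma.
Let S := state_space C.
Let T := exp_op A.

Let md : m_dissipative_on S A.
Proof.
case: gamma_pos => _ gb gs g0.
by apply: damped_m_dissipative => //; exact: closed_range.
Qed.

Definition stable_vector z := forall d : R, 0 < d -> \forall t \near +oo, rnorm (T t z) < d.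

Lemma stable_decay z (q w : R) : 0 < w -> 0 <= q ->
  (forall t : R, 0 <= t -> rnorm (T t z) ^+ 2 <= q / (1 + t * w)) -> stable_vector z.
Proof.
move=> w0 q0 h d d0; near=> t.
have t0 : 0 <= t by near: t; apply: nbhs_pinfty_ge; exact: num_real.
have tq : q / d ^+ 2 / w < t by near: t; apply: nbhs_pinfty_gt; exact: num_real.
have tw : 0 < 1 + t * w by have := mulr_ge0 t0 (ltW w0); lra.
rewrite -ltr_sqr ?nnegrE ?rnorm_ge0 ?(ltW d0) //.
apply: le_lt_trans (h _ t0) _; rewrite ltr_pdivrMr //.
rewrite ltr_pdivrMr // ltr_pdivrMr ?exprn_gt0 // in tq.
rewrite mulrDr mulr1 mulrC; have : 0 < d ^+ 2 by rewrite exprn_gt0.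
by move: tq; rewrite mulrC; lra.
Unshelve. all: by end_near. Qed.

Let Ss : subspace_set S. Proof. exact: mdiss_space md. Qed.

Lemma stable_comb (a : R[i]) x y : S x -> S y -> stable_vector x -> stable_vector y ->
  stable_vector (a *: x + y).
Proof.
move=> Sx Sy sx sy d d0; set k := complex.Re `|a|.
have k0 : 0 <= k by have := normr_ge0 a; rewrite lecE => /andP[].
have k1 : 0 < k + 1 by lra.
have d2 : 0 < d / 2 by lra.
near=> t; have t0 : 0 <= t by near: t; apply: nbhs_pinfty_ge; exact: num_real.
have h1 : rnorm (T t x) < d / 2 / (k + 1) by near: t; apply: sx; exact: divr_gt0.
have h2 : rnorm (T t y) < d / 2 by near: t; exact: sy.
have -> : T t (a *: x + y) = a *: T t x + T t y := exp_linear md t0 a Sx Sy.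
apply: le_lt_trans (ler_rnormD _ _) _; rewrite rnormZc -/k.
rewrite ltr_pdivlMr // in h1; have := rnorm_ge0 (T t x); nra.
Unshelve. all: by end_near. Qed.

Lemma stable_lim (u : nat -> hprod H0 H1) z : S z -> (forall n, S (u n)) ->
  (forall n, stable_vector (u n)) -> u @ \oo --> z -> stable_vector z.
Proof.
move=> Sz Su su uz d d0; have d2 : 0 < d / 2 by lra.
have /cvg_rnormP/(_ _ d2)[N _ uN] := uz; have h := uN N (leqnn N).
near=> t; have t0 : 0 <= t by near: t; apply: nbhs_pinfty_ge; exact: num_real.
have h1 : rnorm (T t (u N)) < d / 2 by near: t; exact: su.
rewrite -(subr0 (T t z)); apply: le_lt_trans (ler_rdistD (T t (u N)) _ _) _.
rewrite subr0; have := exp_nonexpansive md t0 Sz (Su N); rewrite /= in h; lra.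
Unshelve. all: by end_near. Qed.

Lemma damped_eigen n : dom A (hpair (e n) 0) /\
  A (hpair (e n) 0) = - ((2^-1 ^+ n)%:C *: hpair (e n) 0).
Proof.
have [Dn Cn] := e_ker n.
have [[D0 Da] al] := adjoint_linear C_dense.
have a0 : adjoint C 0 = 0 by apply: (adjointP C_dense _).2 => x _; rewrite !linear0r.
split; first by split=> //; split=> //; exact: (ran_subspace C_linear).1.
apply: hprod_eq; first by rewrite damped1 /= a0 sub0r gamma_e.
by rewrite damped2 /= Cn scaler0.
Qed.

Lemma stable_eigen n : stable_vector (hpair (e n) 0).
Proof.
have [Dn En] := damped_eigen n.
have p0 : 0 < 2^-1 ^+ n :> R by rewrite exprn_gt0 // invr_gt0.
apply: (stable_decay p0 ler01) => t t0.
have := exp_eigen_decay md (ltW p0) Dn En t0.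
by rewrite hpair_rnormr0 e1 expr1n.
Qed.

(** Put [a = x - C^* y] and [b = C x], so that [A (x, y) = - (a, b)] as
    [gamma x = x]. Expanding [q] at [u - h A u] gives
    [q u + 2 h (|x|^2 - eps Re <x, Q y> + eps |y|^2 - eps Re <x, Q C x>)
    + h^2 q (a, b)]: the skew terms cancel, and the correction term of [q]
    produces the missing [|y|^2] because [C Q y = y]. *)
Lemma stable_damped z : S z -> (forall n, inner z.1 (e n) = 0) -> stable_vector z.
Proof.
move=> Sz ze.
have [Q [M [Ql QP QM Qx]]] := range_inverse C_linear C_closed C_compact.
(* small enough for [eps |Q|^2 <= 1 - 3 eps], which keeps [q] equivalent to the
   squared norm and leaves a positive multiple of it as dissipation *)
pose eps : R := (M ^+ 2 + 3)^-1.
have M3 : 0 < M ^+ 2 + 3 by have := sqr_ge0 M; lra.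
have eps0 : 0 < eps by rewrite invr_gt0.
have epsM : eps * M ^+ 2 + 3 * eps = 1 by rewrite /eps; field; exact: lt0r_neq0.
pose q (z : hprod H0 H1) := rinner z.1 z.1 + rinner z.2 z.2 - 2 * eps * rinner z.1 (Q z.2).
have qest x y : ran C y -> `|2 * eps * rinner x (Q y)| <= eps * (M ^+ 2 * rinner x x + rinner y y).
  move=> ry; rewrite normrM ger0_norm ?mulr_ge0 ?(ltW eps0) // [2 * _]mulrC -mulrA.
  rewrite ler_pM2l // !rinnerxx.
  have h1 := rcauchy_schwarz x (Q y).
  have h2 := ler_wpM2l (rnorm_ge0 x) (QM _ ry).
  have := sqr_ge0 (M * rnorm x - rnorm y); nra.
have eps3 : eps <= 3^-1 by have := sqr_ge0 M; nra.
have epsE (X Y : R) : eps * (M ^+ 2 * X + Y) = X - 3 * (eps * X) + eps * Y.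
  rewrite mulrDr mulrA (_ : eps * M ^+ 2 = 1 - 3 * eps); first by ring.
  by move: epsM; lra.
have eps_ge0 (X : R) : 0 <= X -> 0 <= eps * X /\ eps * X <= 3^-1 * X.
  by move=> X0; rewrite mulr_ge0 ?(ltW eps0) // ler_wpM2r.
have q_lo (v : hprod H0 H1) : ran C v.2 -> eps * rnorm v ^+ 2 <= q v.
  move=> /(qest v.1); rewrite ler_norml epsE hprod_rnorm /q -!rinnerxx => /andP[_].
  have := eps_ge0 _ (rinner_ge0 v.1); have := eps_ge0 _ (rinner_ge0 v.2).
  have := rinner_ge0 v.1; have := rinner_ge0 v.2; rewrite mulrDr; lra.
have q_hi (v : hprod H0 H1) : ran C v.2 -> q v <= 2 * (rinner v.1 v.1 + rinner v.2 v.2).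
  move=> /(qest v.1); rewrite ler_norml epsE /q => /andP[+ _].
  have := eps_ge0 _ (rinner_ge0 v.1); have := eps_ge0 _ (rinner_ge0 v.2).
  have := rinner_ge0 v.1; have := rinner_ge0 v.2; lra.
pose D := [set z : hprod H0 H1 | S z /\ forall n, inner z.1 (e n) = 0].
have DS : D `<=` S by move=> y [].
have Dz : D z by [].
suff step h y : 0 < h -> D y -> D (resolvent A h y) /\
    (1 + h * (eps / 2)) * q (resolvent A h y) <= q y.
  have e20 : 0 < eps / 2 by lra.
  have qz0 : 0 <= q z by apply: le_trans (q_lo _ Sz); rewrite mulr_ge0 ?sqr_ge0 // ltW.
  apply: (@stable_decay z (q z / eps) (eps / 2)) => //.
    by rewrite divr_ge0 // ltW.
  move=> t t0; rewrite mulrAC ler_pdivlMr // mulrC.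
  apply: (exp_decay md eps0 (ltW e20) DS step _ t0 Dz).
  by move=> y [Sy _]; exact: q_lo.
move=> h0 [Sy ye]; have [Du eu] := resolventP md h0 Sy.
set u := resolvent A h y in Du eu *.
have [Dx [Dy2 Sy2]] := Du.
have y1 : y.1 = u.1 - h%:C *: (A u).1 by rewrite -eu.
have y2 : y.2 = u.2 - h%:C *: (A u).2 by rewrite -eu.
rewrite damped1 in y1; rewrite damped2 in y2.
have ue n : inner u.1 (e n) = 0.
  have [Den Cen] := e_ker n; have Ds := C_linear.1.
  apply: inner_eq0 => a.
  have h1 : rinner y.1 (a *: e n) = 0 by rewrite /rinner linearZr_LR /= ye mulr0.
  have h2 : rinner (adjoint C u.2) (a *: e n) = 0.
    rewrite rinnerC /rinner -(adjointE Dy2); last exact: subspaceZ.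
    by rewrite lin_opZ // Cen scaler0 linear0l.
  have h3 : rinner (gamma u.1) (a *: e n) = 2^-1 ^+ n * rinner u.1 (a *: e n).
    rewrite (pos_sym gamma_pos) linearZ /= gamma_e -rinnerZr.
    by rewrite !scalerA mulrC.
  move: h1; rewrite y1 rinnerBl rinnerZl rinnerBl h2 h3 sub0r => h4.
  have p0 : 0 < h * 2^-1 ^+ n by rewrite mulr_gt0 // exprn_gt0 // invr_gt0.
  by nra.
have gu : gamma u.1 = u.1 by exact: gamma_id.
rewrite gu in y1; have [a aE] : exists a, a = u.1 - adjoint C u.2 by eexists.
have Cx : ran C (C u.1) by exists u.1.
have {}y1 : y.1 = u.1 + h%:C *: a by rewrite y1 aE -scalerN opprB.
have {}y2 : y.2 = u.2 + h%:C *: C u.1 by rewrite y2 scalerN opprK.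
split; first by split.
have hB := q_lo (hpair a (C u.1)) Cx.
have {hB} : 0 <= q (hpair a (C u.1)) by apply: le_trans hB; rewrite mulr_ge0 ?sqr_ge0 // ltW.
have := q_hi u Sy2.
rewrite /q y1 y2 /= (Ql h _ _ Sy2 Cx) !rinnerE.
have e1' : rinner a u.1 = rinner u.1 u.1 - rinner u.2 (C u.1).
  rewrite aE rinnerBl; congr (_ - _).
  by rewrite rinnerC (rinnerC u.2) /rinner -(adjointE Dy2).
have e2' : rinner a (Q u.2) = rinner u.1 (Q u.2) - rinner u.2 u.2.
  have [DQ CQ] := QP _ Sy2; rewrite aE rinnerBl; congr (_ - _).
  by rewrite rinnerC /rinner -(adjointE Dy2) // CQ.
rewrite (rinnerC u.1 a) (rinnerC (C u.1) u.2) e1' e2'.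
have := Qx _ Dx; rewrite -rinnerxx.
have := qest u.1 _ Sy2; rewrite ler_norml epsE => /andP[_].
have := eps_ge0 _ (rinner_ge0 u.1); have := eps_ge0 _ (rinner_ge0 u.2).
have := rinner_ge0 u.1; have := rinner_ge0 u.2.
set X := rinner u.1 u.1; set Y := rinner u.2 u.2; set V := rinner u.2 (C u.1).
set XQ := rinner u.1 (Q u.2); set XB := rinner u.1 (Q (C u.1)).
set AA := rinner a a; set BB := rinner (C u.1) (C u.1); set AB := rinner a (Q (C u.1)).
move=> Y0 X0 [eY0 _] [eX0 eX3] xq xb qh qB.
have b0 : 0 <= 2 * (X - eps * XQ + eps * Y - eps * XB) - eps / 2 * (X + Y - 2 * eps * XQ).
  have := ler_wpM2l (ltW eps0) xb; have := ler_wpM2l (ltW eps0) qh; lra.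
have := mulr_ge0 (ltW h0) b0; have := mulr_ge0 (sqr_ge0 h) qB.
rewrite -subr_ge0 => k1 k2; rewrite -subr_ge0.
apply: le_trans (addr_ge0 k1 k2) _; rewrite le_eqVlt; apply/orP; left; apply/eqP; ring.
Qed.

(** Split [(x, y)] as [(x, 0) + (0, y)]. The second vector is covered by
    [stable_damped]; for the first, a vector orthogonal to all stable [x] is
    orthogonal to every [e_n], hence stable itself, hence [0]. *)
Lemma damped_strongly_stable : strongly_stable S T.
Proof.
have st : forall z, S z -> stable_vector z.
  pose F := [set x : H0 | stable_vector (hpair x (0 : H1))].
  have S1 x : S (hpair x 0) by exact: (ran_subspace C_linear).1.
  have S2 y : ran C y -> S (hpair 0 y) by [].
  have Fs : subspace_set F.
    split; first by apply: stable_damped => // n; rewrite linear0l.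
    move=> a x y Fx Fy; rewrite /F /=.
    have -> : hpair (a *: x + y) (0 : H1) = a *: hpair x 0 + hpair y 0.
      by apply: hprod_eq; rewrite //= scaler0 addr0.
    exact: stable_comb.
  have Fc : seq_closed F.
    move=> u l Fu ul; apply: (@stable_lim (fun n => hpair (u n) 0)) => //.
    apply/cvg_rnormP => d d0; move/cvg_rnormP: ul => /(_ _ d0); apply: filterS => n.
    rewrite (_ : hpair l 0 - hpair (u n) 0 = hpair (l - u n) 0) ?hpair_rnormr0 //.
    by apply: hprod_eq; rewrite //= subr0.
  have FT x : F x.
    suff : [set: H0] `<=` F by apply.
    apply: subspace_total => // r _ rF.
    have re n : inner r (e n) = 0.
      apply: inner_eq0 => a; apply: rF; apply: (subspaceZ Fs); exact: stable_eigen.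
    apply: rinner_eq0; apply: rF; exact: stable_damped.
  move=> [x y] Sxy.
  have -> : (x, y) = 1 *: hpair x 0 + hpair 0 y.
    by rewrite scale1r; apply: hprod_eq; rewrite /= ?addr0 ?add0r.
  apply: stable_comb => //; first exact: FT.
  by apply: stable_damped => // n; rewrite linear0l.
move=> z Sz; apply/cvgrPdist_lt => d d0.
have dE : d = (complex.Re d)%:C by rewrite RRe_real // gtr0_real.
move: d0; rewrite dE ltcR => d0; apply: filterS (st z Sz _ d0) => t.
by rewrite sub0r normrN normr_id rnormE ltcR.
Qed.

(** [|T_t z - z| <= t |A z|] gives [|T_t (e_n, 0)| >= 1 - t 2^-n], whereas the graph
    norm of [(e_n, 0)] is at most [2]. Letting [n] grow, any admissible [f]
    satisfies [1 <= 2 f t] for every [t]. *)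
Lemma damped_not_semi_uniformly_stable : ~ semi_uniformly_stable S T.
Proof.
move=> [f [f0 [fc ft]]].
have [Gd Gv] := exp_generator md.
have f1 t : 0 <= t -> 1 <= 2 * f t.
  move=> t0; have c : 1 - t * 2^-1 ^+ n @[n --> \oo] --> (1 : R).
    rewrite -[X in _ --> X](subr0 1) -(mulr0 t).
    apply: cvgB; first exact: cvg_cst.
    by apply: cvgMr; apply: cvg_expr; rewrite ger0_norm ?invr_ge0 // invf_lt1 // ltr1n.
  apply: (cvgr_to_le c); apply: nearW => n.
  have [Dn En] := damped_eigen n.
  have p0 : 0 <= 2^-1 ^+ n :> R by rewrite exprn_ge0 // invr_ge0.
  have p1 : 2^-1 ^+ n <= 1 :> R by rewrite exprn_ile1 // ?invr_ge0 // invf_le1 // ler1n.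
  have An : rnorm (A (hpair (e n) 0)) = 2^-1 ^+ n.
    by rewrite En rnormN rnormZ hpair_rnormr0 e1 mulr1 ger0_norm.
  have DG : dom (generator S T) (hpair (e n) 0) by rewrite Gd.
  have := ft _ t DG t0; rewrite rnormE => h1.
  have : (rnorm (T t (hpair (e n) 0)))%:C <= (f t * 2)%:C.
    apply: le_trans h1 _; rewrite rmorphM /=; apply: ler_wpM2l; first by rewrite ler0c f0.
    apply: le_trans (graph_norm_le _ _) _; rewrite lecR Gv // An hpair_rnormr0 e1; lra.
  rewrite lecR => h2.
  have := exp_increment md t0 Dn; rewrite An => h3.
  have := ler_rdistD (T t (hpair (e n) 0)) (hpair (e n) 0) 0.
  rewrite !subr0 hpair_rnormr0 e1 rdistC; lra.
move/cvgrPdist_lt: fc => /(_ 4^-1) []; first by rewrite invr_gt0.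
move=> N [Nr Nf]; have := Nf (Num.max 0 N + 1).
rewrite sub0r normrN => /(_ _) h.
have m0 : 0 <= Num.max 0 N + 1 by rewrite addr_ge0 // le_max lexx.
have : `|f (Num.max 0 N + 1)| < 4^-1.
  by apply: h; rewrite (le_lt_trans (_ : N <= Num.max 0 N)) ?le_max ?lexx ?orbT // ltrDl.
rewrite ger0_norm ?f0 //; have := f1 _ m0; lra.
Qed.

End Stability.

Theorem theorem5p9 (R : realType) (H0 H1 : hilbertType R)
    (C : operator H0 H1) (C_linear : linear_op C)
    (C_dense : densely_defined C) (C_closed : closed_op C)
    (C_compact : compact_graph_embedding C
       (dom C `&` orthogonal_compl (ker C)))
    (C_ker : ~ finite_dim (ker C)) :
  exists gamma : {linear H0 -> H0},
    [/\ bounded_on setT gamma,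
        self_adjoint (total_op gamma),
        nonneg_op (total_op gamma) &
        exists T : R -> hprod H0 H1 -> hprod H0 H1,
          [/\ generates (state_space C) (damped_op C gamma) T,
              strongly_stable (state_space C) T &
              ~ semi_uniformly_stable (state_space C) T]].
Proof.
have [e [g [eP gp gid ge]]] := degenerate_damping (ker_subspace C_linear) C_ker.
pose gamma : {linear H0 -> H0} := HB.pack g (GRing.isLinear.Build _ _ _ _ g (pos_linear gp)).
have gammap : positive_bounded gamma by [].
have e_ker n : ker C (e n) := (eP n).1.
have e1 n : rnorm (e n) = 1 := (eP n).2.
have gsym x y : inner (gamma x) y = inner x (gamma y).
  by apply: inner_eqP => a; rewrite -linearZ; exact: (pos_sym gammap).
exists gamma; split.
- have [K _ gK] := pos_bounded gp; exists K%:C => x _.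
  by rewrite !rnormE -rmorphM lecR.
- have dT : densely_defined (total_op gamma).
    by move=> O [x Ox] _; exists x.
  have adj y : dom (adjoint (total_op gamma)) y /\ adjoint (total_op gamma) y = gamma y.
    by apply: adjointP => // x _; exact: gsym.
  split; last by move=> x _; rewrite (adj x).2.
  by apply/seteqP; split=> // y _; exact: (adj y).1.
- move=> x _; suff : 0 <= inner (gamma x) x by [].
  have xx := esym (hermitian_subproof (s := inner) x (gamma x)).
  rewrite expr0 mul1r /= -(gsym x x : _ = inner x (gamma x)) in xx.
  have := pos_ge0 gammap x; rewrite /rinner lecE.
  move: xx; case: (inner (gamma x) x) => a b /= [bb] ->.
  by rewrite andbT; apply/eqP; lra.
have md : m_dissipative_on (state_space C) (damped_op C gamma).
  case: gammap => _ gb gs g0.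
  by apply: damped_m_dissipative => //; exact: closed_range.
exists (exp_op (damped_op C gamma)); split.
- by split; [exact: exp_C0|exact: exp_generator].
- exact: (damped_strongly_stable C_linear C_dense C_closed C_compact gammap
    e_ker e1 gid ge).
- exact: (damped_not_semi_uniformly_stable C_linear C_dense C_closed C_compact
    gammap e_ker e1 ge).
Qed.
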